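(* Let $m\ge 1$ be an integer and let $L(s)=\prod_{p}\prod_{j=1}^{m}(1-c_j(p)p^{-s})^{-1}$ ($s=\sigma+it$, $\sigma>1$), where $|c_j(p)|\le 1$. Let $N\ge 16$ be an integer and $0<\delta<7/2$. Assume: (i) $L(s)$ continues analytically to a holomorphic function on $\sigma\ge\sigma_L$ for some $1/2\le\sigma_L<1$ with $\delta<7(1-\sigma_L)$; (ii) $L(s)$ has no zero in $D_{\delta,N}=\{\sigma\ge 1\}\cup\{1-\delta/7\le\sigma<1,\ |t|\le 2(\log N)^3\}$; (iii) $L(s)\ll N^{\gamma_1}(1+|t|)^{\gamma_2}$ for $\sigma_L<\sigma<4$, with fixed constants $\gamma_1,\gamma_2>0$. Then \[ \log L(1)=\sum_{p\le(\log N)^{14/\delta}}\frac{d_p(1)}{p}+C(1)+O_\delta\Big(\frac{1}{\log\log N}\Big). \]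
   Context: $p$ runs over primes. $d_p(\ell)=\sum_{j=1}^m c_j(p)^\ell$, and for $\alpha>1/2$, $C(\alpha)=\sum_p\sum_{\ell=2}^\infty \frac{d_p(\ell)}{\ell p^{\ell\alpha}}$. $\log L(s)$ denotes the branch of the logarithm that is holomorphic on the (simply connected, zero-free) region $D_{\delta,N}$ and equals $\sum_p\sum_{\ell\ge1}\frac{d_p(\ell)}{\ell p^{\ell s}}$ for $\sigma>1$. Implied constants may depend on $m,\gamma_1,\gamma_2$ and on $\delta$. *)

(* Defs.v *)
From Stdlib Require Import Reals ZArith Znumtheory List.
From Coquelicot Require Import Coquelicot.
Open Scope R_scope.

Definition Cexp (z : C) : C :=
  (exp (Re z) * cos (Im z), exp (Re z) * sin (Im z)).

(* n^s = exp (s log n), with the real logarithm; meant for n >= 1. *)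
Definition npow (n : nat) (s : C) : C := Cexp (s * ln (INR n))%C.

(* Like [Series], a total operator: the value is meaningful when the real and
   imaginary parts of the partial sums converge. *)
Definition CSeries (a : nat -> C) : C :=
  (Series (fun n => Re (a n)), Series (fun n => Im (a n))).

Definition primeb (n : nat) : bool :=
  if prime_dec (Z.of_nat n) then true else false.

Definition primes_le (x : R) : list nat :=
  filter primeb (seq 0 (S (Z.to_nat (Int_part x)))).

(* The sum over all primes, taken in increasing order. *)
Definition prime_series (a : nat -> C) : C :=
  CSeries (fun p => if primeb p then a p else RtoC 0).

(* Throughout, [c p j] with 1 <= j <= m is the coefficient c_j(p); values at
   composite p or at other j are irrelevant. *)

Definition euler_factor (m : nat) (c : nat -> nat -> C) (s : C) (p : nat) : C :=
  Iter.iter Cmult (RtoC 1) (seq 1 m)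
    (fun j => / (1 - c p j * npow p (- s)))%C.

Definition euler_product (m : nat) (c : nat -> nat -> C) (s l : C) : Prop :=
  filterlim
    (fun n : nat =>
       Iter.iter Cmult (RtoC 1) (primes_le (INR n)) (euler_factor m c s))
    eventually (locally l).

Definition d_coef (m : nat) (c : nat -> nat -> C) (p l : nat) : C :=
  Iter.iter Cplus (RtoC 0) (seq 1 m) (fun j => Cpow (c p j) l).

Definition log_term (m : nat) (c : nat -> nat -> C) (s : C) (p l : nat) : C :=
  (d_coef m c p l / (INR l * npow p (INR l * s)))%C.

Definition log_series (m : nat) (c : nat -> nat -> C) (s : C) : C :=
  prime_series (fun p => CSeries (fun k => log_term m c s p (k + 1))).

Definition C_const (m : nat) (c : nat -> nat -> C) (alpha : R) : C :=
  prime_series (fun p => CSeries (fun k => log_term m c alpha p (k + 2))).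

(* Complex differentiability at every point of A, relative to A. At interior
   points of A this is Coquelicot's [ex_derive] over C; at the boundary only
   values of f on A matter, so f may be arbitrary outside A. *)
Definition holomorphic_on (A : C -> Prop) (f : C -> C) : Prop :=
  forall z : C, A z ->
    exists l : C,
      @filterdiff C_AbsRing (AbsRing_NormedModule C_AbsRing) C_NormedModule
        f (within A (@locally (AbsRing_UniformSpace C_AbsRing) z))
        (fun h => scal h l).

Definition D_region (delta : R) (N : nat) (s : C) : Prop :=
  1 <= Re s \/
  (1 - delta / 7 <= Re s < 1 /\ Rabs (Im s) <= 2 * ln (INR N) ^ 3).

(* logL restricted to D is the branch of log L that is given by the Dirichlet
   series for Re s > 1. *)
Definition is_log_branch (m : nat) (c : nat -> nat -> C) (L : C -> C)
    (D : C -> Prop) (logL : C -> C) : Prop :=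
  holomorphic_on D logL /\
  (forall s : C, D s -> Cexp (logL s) = L s) /\
  (forall s : C, 1 < Re s -> logL s = log_series m c s).

(* Main.v *)
(* The proof adapts Newman's contour argument. Put w = s - 1 and
   X = floor ((log N)^(14/delta)), remove from log L(1 + w) the harmless terms
   with l >= 2, and integrate the rest, g(w), against X^w (1/w + w/R^2) over
   the boundary of [-b, R] x [-R, R]; integrate S(w) = sum_{p <= X} d_p(1) p^(-1-w)
   in the same way over [-R, R]^2. By the residue theorem the difference of the
   two integrals is 2 pi i (g(0) - S(0)). For Re w > 0 the difference g - S is
   the tail of a Dirichlet series with bounded coefficients, so that its contour
   integral is O(1/R); so is that of S for Re w < 0. For Re w < 0 hypothesis (iii)
   and a Borel-Caratheodory argument give g << log N. With R = (log N)^(2/3) and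
   b = (11/12) (delta/7) every contribution is O((log N)^(-1/6)). *)

Require Import Defs.
From Stdlib Require Import Reals ZArith Znumtheory List.
From Coquelicot Require Import Coquelicot.
From Stdlib Require Import Bool Lra Lia Psatz.
Open Scope R_scope.

(** * Complex differentiability *)

(** Apart from the factor X^(-Re w), the bounds for g - S and for S are of order 1/|Re w|, while the
    contours cross the imaginary axis at w = iR and w = -iR. The kernel is (X^w / w)(1 + w^2 / R^2),
    which vanishes at exactly these two points; this zero absorbs the singularity and leaves O(1/R)
    without a logarithm. With squares in place of Newman's circles, all contour integrals reduce to
    Goursat's theorem on rectangles and a real arctangent integral. The side Re w = -b contributes
    about R X^(-b) log N, and X^b is (log N)^(11/6) up to a constant, so that R = (log N)^(2/3)
    leaves (log N)^(-1/6). The twelfth of delta/7 that b gives up is room for the squares of the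
    Borel-Caratheodory estimate. Since delta < 7/2, one has 1 - b >= 13/24, and the terms with l >=
    2 are dominated by p^(-13/12) times a geometric series of ratio 3/4: this is the origin of 13/24
    and 1/12, and of 48 = 4 * 12, where 4 sums the geometric series and 12 bounds the sum of
    n^(-13/12) over n >= 2. *)

Lemma Cmod_sq (z : C) : Cmod z * Cmod z = Re z * Re z + Im z * Im z.
Proof.
  generalize (Cmod2_alt z); simpl; intros H.
  rewrite !Rmult_1_r in H. exact H.
Qed.

Lemma Cmod_le_abs (z : C) : Cmod z <= Rabs (Re z) + Rabs (Im z).
Proof.
  assert (H := Cmod_sq z).
  assert (H1 : Re z * Re z = Rabs (Re z) * Rabs (Re z)) by (rewrite <- Rabs_mult, Rabs_right; nra).
  assert (H2 : Im z * Im z = Rabs (Im z) * Rabs (Im z)) by (rewrite <- Rabs_mult, Rabs_right; nra).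
  assert (H3 := Rabs_pos (Re z)). assert (H4 := Rabs_pos (Im z)).
  assert (H5 := Cmod_ge_0 z). nra.
Qed.

Lemma im_le_Cmod (z : C) : Rabs (Im z) <= Cmod z.
Proof.
  eapply Rle_trans; [apply Rmax_r | apply (Rmax_Cmod z)].
Qed.

(** The neighbourhoods here are those of the product R x R, whose balls are squares; a square of
    half-side d/2 lies in the disc of radius d. *)
Lemma locally_Cmod (z : C) (P : C -> Prop) :
  locally z P <-> exists d, 0 < d /\ forall w, Cmod (w - z) < d -> P w.
Proof.
  split.
  - intros [e He]. exists e. split; [apply cond_pos|].
    intros w Hw. apply He. apply C_NormedModule_mixin_compat1. exact Hw.
  - intros [d [Hd H]].
    assert (Hd2 : 0 < d / 2) by lra.
    exists (mkposreal _ Hd2). intros w [H1 H2]. apply H.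
    eapply Rle_lt_trans; [apply Cmod_le_abs|].
    change (Rabs (fst w - fst z) < d / 2) in H1.
    change (Rabs (snd w - snd z) < d / 2) in H2.
    change (Rabs (fst w - fst z) + Rabs (snd w - snd z) < d). lra.
Qed.

Lemma locally_all (z : C) (P : C -> Prop) : (forall w : C, P w) -> locally z P.
Proof. intros H. apply filter_forall. exact H. Qed.

Lemma locally_imp (z : C) (P Q : C -> Prop) :
  (forall w : C, P w -> Q w) -> locally z P -> locally z Q.
Proof. intros H. apply filter_imp. exact H. Qed.

Lemma locally_and (z : C) (P Q : C -> Prop) :
  locally z P -> locally z Q -> locally z (fun w => P w /\ Q w).
Proof. apply filter_and. Qed.

(** [C] carries more than one uniform structure; the product structure is fixed here on both
    sides. *)
Definition Ccont (f : C -> C) (z : C) : Prop :=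
  @continuous C_UniformSpace C_UniformSpace f z.

Lemma Ccont_eps (f : C -> C) (z : C) :
  Ccont f z <-> forall eps, 0 < eps -> locally z (fun w => Cmod (f w - f z) < eps).
Proof.
  split.
  - intros H eps He. apply (H (fun y => Cmod (y - f z) < eps)).
    apply locally_Cmod. exists eps. auto.
  - intros H P HP. apply locally_Cmod in HP. destruct HP as [d [Hd HP]].
    change (locally z (fun w => P (f w))).
    generalize (H d Hd). apply locally_imp. intros w Hw. now apply HP.
Qed.

Lemma Ccont_pair (f : C -> C) (z : C) :
  continuous (fun w => Re (f w)) z -> continuous (fun w => Im (f w)) z -> Ccont f z.
Proof.
  intros H1 H2. apply Ccont_eps. intros eps He.
  assert (He2 : 0 < eps / 2) by lra.
  assert (K1 : locally z (fun w => Rabs (Re (f w) - Re (f z)) < eps / 2))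
    by exact (H1 _ (locally_ball (Re (f z)) (mkposreal _ He2))).
  assert (K2 : locally z (fun w => Rabs (Im (f w) - Im (f z)) < eps / 2))
    by exact (H2 _ (locally_ball (Im (f z)) (mkposreal _ He2))).
  generalize (locally_and _ _ _ K1 K2). apply locally_imp.
  intros w [J1 J2].
  eapply Rle_lt_trans; [apply Cmod_le_abs|].
  change (Rabs (Re (f w) - Re (f z)) + Rabs (Im (f w) - Im (f z)) < eps). lra.
Qed.

Lemma Ccont_Re (f : C -> C) (z : C) : Ccont f z -> continuous (fun w => Re (f w)) z.
Proof.
  intros H. apply (continuous_comp f (fun y : C => Re y)); [exact H|].
  unfold Re. destruct (f z). apply continuous_fst.
Qed.

Lemma Ccont_Im (f : C -> C) (z : C) : Ccont f z -> continuous (fun w => Im (f w)) z.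
Proof.
  intros H. apply (continuous_comp f (fun y : C => Im y)); [exact H|].
  unfold Im. destruct (f z). apply continuous_snd.
Qed.

Lemma Ccont_const (a z : C) : Ccont (fun _ => a) z.
Proof. apply continuous_const. Qed.

Lemma Ccont_id (z : C) : Ccont (fun w => w) z.
Proof. apply continuous_id. Qed.

Lemma Ccont_comp (f g : C -> C) (z : C) :
  Ccont f z -> Ccont g (f z) -> Ccont (fun w => g (f w)) z.
Proof. apply continuous_comp. Qed.

Lemma Ccont_plus (f g : C -> C) (z : C) :
  Ccont f z -> Ccont g z -> Ccont (fun w => (f w + g w)%C) z.
Proof. exact (@continuous_plus C_UniformSpace R_AbsRing C_R_NormedModule f g z). Qed.

Lemma Ccont_mult (f g : C -> C) (z : C) :
  Ccont f z -> Ccont g z -> Ccont (fun w => (f w * g w)%C) z.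
Proof.
  intros Hf Hg.
  assert (F1 := Ccont_Re _ _ Hf). assert (F2 := Ccont_Im _ _ Hf).
  assert (G1 := Ccont_Re _ _ Hg). assert (G2 := Ccont_Im _ _ Hg).
  apply Ccont_pair.
  - apply (continuous_minus (V := R_NormedModule)); apply (continuous_mult (K := R_AbsRing)); assumption.
  - apply (continuous_plus (V := R_NormedModule)); apply (continuous_mult (K := R_AbsRing)); assumption.
Qed.

Lemma continuous_R_comp (g : R -> R) (f : C -> R) (z : C) :
  continuous f z -> continuity_pt g (f z) -> continuous (fun w => g (f w)) z.
Proof.
  intros Hf Hg. apply (continuous_comp f g); [exact Hf|].
  now apply continuity_pt_filterlim.
Qed.

Lemma Ccont_inv (f : C -> C) (z : C) :
  Ccont f z -> f z <> 0%C -> Ccont (fun w => (/ f w)%C) z.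
Proof.
  intros Hf Hz.
  assert (F1 := Ccont_Re _ _ Hf). assert (F2 := Ccont_Im _ _ Hf).
  assert (Hn : Re (f z) * Re (f z) + Im (f z) * Im (f z) <> 0).
  { rewrite <- Cmod_sq. apply Cmod_gt_0 in Hz. nra. }
  (* The coordinates of 1/z are Re z / |z|^2 and - Im z / |z|^2, so only the real function 1/|f|^2
     needs an argument. *)
  assert (Hd : continuous (fun w => / (Re (f w) ^ 2 + Im (f w) ^ 2)) z).
  { apply (continuous_R_comp Rinv (fun w => Re (f w) ^ 2 + Im (f w) ^ 2)).
    - simpl. apply (continuous_plus (V := R_NormedModule)).
      + apply (continuous_mult (K := R_AbsRing)); [assumption|].
        apply (continuous_mult (K := R_AbsRing)); [assumption|apply continuous_const].
      + apply (continuous_mult (K := R_AbsRing)); [assumption|].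
        apply (continuous_mult (K := R_AbsRing)); [assumption|apply continuous_const].
    - apply continuity_pt_inv; [apply derivable_continuous_pt, derivable_pt_id|].
      unfold id. simpl. rewrite !Rmult_1_r. exact Hn. }
  apply Ccont_pair.
  - apply (continuous_mult (K := R_AbsRing)); assumption.
  - apply (continuous_mult (K := R_AbsRing)); [|assumption].
    apply (continuous_opp (V := R_NormedModule)). assumption.
Qed.

Lemma Ccont_near_neq0 (f : C -> C) (z : C) :
  Ccont f z -> f z <> 0%C -> locally z (fun w => f w <> 0%C).
Proof.
  intros Hf Hz. apply Cmod_gt_0 in Hz.
  generalize (proj1 (Ccont_eps f z) Hf _ Hz). apply locally_imp.
  intros w Hw E. rewrite E in Hw.
  replace (0 - f z)%C with (- f z)%C in Hw by ring.
  rewrite Cmod_opp in Hw. lra.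
Qed.

(* Caratheodory's form of differentiability: phi is the difference quotient
   extended continuously to z. *)
Definition Cderiv (f : C -> C) (z l : C) : Prop :=
  exists phi : C -> C, Ccont phi z /\ phi z = l /\
    locally z (fun w => f w = (f z + (w - z) * phi w)%C).

Lemma Ccont_ext_loc (f g : C -> C) (z : C) :
  locally z (fun w => f w = g w) -> Ccont f z -> Ccont g z.
Proof. apply continuous_ext_loc. Qed.

Lemma Cderiv_cont (f : C -> C) (z l : C) : Cderiv f z l -> Ccont f z.
Proof.
  intros [phi [H1 [_ H2]]].
  apply (Ccont_ext_loc (fun w => (f z + (w - z) * phi w)%C)).
  - revert H2. apply locally_imp. auto.
  - apply Ccont_plus; [apply Ccont_const|]. apply Ccont_mult; [|exact H1].
    apply Ccont_plus; [apply Ccont_id|apply Ccont_const].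
Qed.

Lemma Cderiv_ext (f g : C -> C) (z l : C) :
  (forall w, f w = g w) -> Cderiv f z l -> Cderiv g z l.
Proof.
  intros E [phi [H1 [H2 H3]]]. exists phi. repeat split; auto.
  revert H3. apply locally_imp. intros w. now rewrite !E.
Qed.

Lemma Cderiv_eq (f : C -> C) (z l l' : C) : l = l' -> Cderiv f z l -> Cderiv f z l'.
Proof. now intros ->. Qed.

Lemma Cderiv_const (a z : C) : Cderiv (fun _ => a) z 0.
Proof.
  exists (fun _ => 0%C). repeat split; [apply Ccont_const|].
  apply locally_all. intros. ring.
Qed.

Lemma Cderiv_id (z : C) : Cderiv (fun w => w) z 1.
Proof.
  exists (fun _ => 1%C). repeat split; [apply Ccont_const|].
  apply locally_all. intros. ring.
Qed.

Lemma Cderiv_plus (f g : C -> C) (z l k : C) :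
  Cderiv f z l -> Cderiv g z k -> Cderiv (fun w => (f w + g w)%C) z (l + k).
Proof.
  intros [p [H1 [H2 H3]]] [q [K1 [K2 K3]]].
  exists (fun w => (p w + q w)%C). split; [now apply Ccont_plus|]. split; [now rewrite H2, K2|].
  generalize (locally_and _ _ _ H3 K3). apply locally_imp.
  intros w [-> ->]. ring.
Qed.

Lemma Cderiv_mult (f g : C -> C) (z l k : C) :
  Cderiv f z l -> Cderiv g z k ->
  Cderiv (fun w => (f w * g w)%C) z (l * g z + f z * k).
Proof.
  intros Hf Hg. assert (Cg := Cderiv_cont _ _ _ Hg).
  destruct Hf as [p [H1 [H2 H3]]]. destruct Hg as [q [K1 [K2 K3]]].
  exists (fun w => (p w * g w + f z * q w)%C). split; [|split].
  - apply Ccont_plus; apply Ccont_mult; auto. apply Ccont_const.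
  - now rewrite H2, K2.
  - generalize (locally_and _ _ _ H3 K3). apply locally_imp.
    intros w [E1 E2]. rewrite E1. 
    replace (g w) with (g z + (w - z) * q w)%C by auto. ring.
Qed.

Lemma Cderiv_inv (f : C -> C) (z l : C) :
  Cderiv f z l -> f z <> 0%C -> Cderiv (fun w => (/ f w)%C) z (- l / (f z * f z)).
Proof.
  intros Hf Hz. assert (Cf := Cderiv_cont _ _ _ Hf).
  destruct Hf as [p [H1 [H2 H3]]].
  exists (fun w => (- p w / (f z * f w))%C). split; [|split].
  - apply Ccont_mult.
    + apply (Ccont_ext_loc (fun w => (- (1) * p w)%C)).
      * apply locally_all. intros. ring.
      * apply Ccont_mult; [apply Ccont_const|auto].
    + apply Ccont_inv.
      * apply Ccont_mult; [apply Ccont_const|auto].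
      * now apply Cmult_neq_0.
  - now rewrite H2.
  - generalize (locally_and _ _ _ H3 (Ccont_near_neq0 _ _ Cf Hz)). apply locally_imp.
    intros w [E1 E2].
    assert (E3 : ((w - z) * p w = f w - f z)%C) by (rewrite E1; ring).
    replace ((w - z) * (- p w / (f z * f w)))%C
      with (- ((w - z) * p w) / (f z * f w))%C by (field; split; auto).
    rewrite E3. field; split; auto.
Qed.

(** In Caratheodory's form the quotients multiply, g(f w) - g(f z) = (w - z) p(w) q(f w), and the
    case f w = f z needs no separate treatment. *)
Lemma Cderiv_comp (f g : C -> C) (z l k : C) :
  Cderiv f z l -> Cderiv g (f z) k -> Cderiv (fun w => g (f w)) z (k * l).
Proof.
  intros Hf Hg. assert (Cf := Cderiv_cont _ _ _ Hf).
  destruct Hf as [p [H1 [H2 H3]]]. destruct Hg as [q [K1 [K2 K3]]].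
  exists (fun w => (q (f w) * p w)%C). split; [|split].
  - apply Ccont_mult; auto. now apply (Ccont_comp f q).
  - now rewrite H2, K2.
  - apply Cf in K3. generalize (locally_and _ _ _ H3 K3). apply locally_imp.
    intros w [E1 E2]. rewrite E2.
    replace (f w - f z)%C with ((w - z) * p w)%C by (rewrite E1; ring). ring.
Qed.

Lemma Cderiv_opp (f : C -> C) (z l : C) :
  Cderiv f z l -> Cderiv (fun w => (- f w)%C) z (- l).
Proof.
  intros H. apply (Cderiv_ext (fun w => (- (1) * f w)%C)); [intros; ring|].
  apply (Cderiv_eq _ _ (0 * f z + - (1) * l)%C); [ring|].
  apply (Cderiv_mult (fun _ => (- (1))%C) f); [apply Cderiv_const|exact H].
Qed.

Lemma Cderiv_minus (f g : C -> C) (z l k : C) :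
  Cderiv f z l -> Cderiv g z k -> Cderiv (fun w => (f w - g w)%C) z (l - k).
Proof. intros. apply Cderiv_plus; auto. now apply Cderiv_opp. Qed.

Lemma Cderiv_littleo (f : C -> C) (z l : C) :
  (forall eps, 0 < eps -> locally z (fun w =>
     Cmod (f w - f z - l * (w - z)) <= eps * Cmod (w - z))) ->
  Cderiv f z l.
Proof.
  intros H.
  set (phi := fun w : C => if Ceq_dec w z then l else ((f w - f z) / (w - z))%C).
  assert (E : phi z = l) by (unfold phi; destruct (Ceq_dec z z); congruence).
  exists phi. split; [|split; [exact E|]].
  - apply Ccont_eps. intros eps He. rewrite E.
    assert (He2 : 0 < eps / 2) by lra.
    generalize (H _ He2). apply locally_imp. intros w Hw.
    unfold phi. destruct (Ceq_dec w z) as [_|n].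
    + replace (l - l)%C with (RtoC 0) by ring. rewrite Cmod_0. lra.
    + assert (n' : (w - z)%C <> 0%C).
      { intros F. apply n. replace w with ((w - z) + z)%C by ring. rewrite F. ring. }
      replace ((f w - f z) / (w - z) - l)%C with ((f w - f z - l * (w - z)) / (w - z))%C by (field; auto).
      rewrite Cmod_div by auto. apply Cmod_gt_0 in n'.
      apply Rle_lt_trans with (eps / 2); [|lra].
      apply Rmult_le_reg_r with (Cmod (w - z)); [lra|].
      unfold Rdiv at 1. rewrite Rmult_assoc, Rinv_l by lra. lra.
  - apply locally_all. intros w. unfold phi. destruct (Ceq_dec w z) as [->|n]; [ring|].
    field. intros F. apply n. replace w with ((w - z) + z)%C by ring. rewrite F. ring.
Qed.

Lemma littleo_Cderiv (f : C -> C) (z l : C) : Cderiv f z l ->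
  forall eps, 0 < eps -> locally z (fun w =>
     Cmod (f w - f z - l * (w - z)) <= eps * Cmod (w - z)).
Proof.
  intros [p [H1 [H2 H3]]] eps He.
  generalize (locally_and _ _ _ H3 (proj1 (Ccont_eps p z) H1 _ He)). apply locally_imp.
  intros w [E1 E2].
  replace (f w - f z - l * (w - z))%C with ((p w - p z) * (w - z))%C by (rewrite E1, H2; ring).
  rewrite Cmod_mult. apply Rmult_le_compat_r; [apply Cmod_ge_0|lra].
Qed.

Lemma holomorphic_on_Cderiv (A : C -> Prop) (f : C -> C) (z : C) :
  holomorphic_on A f -> locally z A -> exists l, Cderiv f z l.
Proof.
  intros H HA. destruct (H z (locally_singleton _ _ HA)) as [l [_ Hl]].
  exists l. apply Cderiv_littleo. intros eps He.
  (* [filterdiff] speaks of every limit of the filter [within A (locally z)]; only the limit z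
     itself is used. *)
  assert (Hlim : @is_filter_lim (AbsRing_UniformSpace C_AbsRing) (within A (@locally (AbsRing_UniformSpace C_AbsRing) z)) z).
  { intros P HP. exact (filter_imp P (fun w => A w -> P w) (fun w Hw _ => Hw) HP). }
  specialize (Hl z Hlim (mkposreal _ He)).
  destruct Hl as [e Hl].
  assert (Hloc : locally z (fun w => A w -> Cmod (f w - f z - l * (w - z)) <= eps * Cmod (w - z))).
  { apply locally_Cmod. exists e. split; [apply cond_pos|].
    intros w Hw Aw.
    assert (K := Hl w Hw Aw).
    change (Cmod (f w - f z - (w - z) * l) <= eps * Cmod (w - z)) in K.
    replace (l * (w - z))%C with ((w - z) * l)%C by ring. exact K. }
  generalize (locally_and _ _ _ HA Hloc). apply locally_imp. tauto.
Qed.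

(** * Integrals of complex-valued functions *)

Lemma Cexp_plus (z w : C) : Cexp (z + w) = (Cexp z * Cexp w)%C.
Proof.
  unfold Cexp. destruct z as [x y], w as [u v]. simpl.
  rewrite exp_plus, cos_plus, sin_plus. unfold Cmult. simpl. f_equal; ring.
Qed.

Lemma Cexp_0 : Cexp 0 = 1%C.
Proof. unfold Cexp. simpl. rewrite exp_0, cos_0, sin_0. unfold RtoC. f_equal; ring. Qed.

Lemma Cmod_Cexp (z : C) : Cmod (Cexp z) = exp (Re z).
Proof.
  assert (H := Cmod_sq (Cexp z)). unfold Cexp at 3 4 5 6 in H. simpl in H.
  assert (E := sin2_cos2 (Im z)). unfold Rsqr in E.
  assert (P := exp_pos (Re z)). assert (Q := Cmod_ge_0 (Cexp z)).
  assert (K : Cmod (Cexp z) * Cmod (Cexp z) = exp (Re z) * exp (Re z)).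
  { rewrite H.
    transitivity (exp (Re z) * exp (Re z) * (sin (Im z) * sin (Im z) + cos (Im z) * cos (Im z))).
    ring. rewrite E. ring. }
  nra.
Qed.

Lemma derivable_littleo (f : R -> R) (l : R) : derivable_pt_lim f 0 l ->
  forall eps, 0 < eps -> exists d, 0 < d /\ forall h, Rabs h < d ->
    Rabs (f h - f 0 - l * h) <= eps * Rabs h.
Proof.
  intros H eps He. destruct (H eps He) as [d Hd]. exists d. split; [apply cond_pos|].
  intros h Hh. destruct (Req_dec h 0) as [->|n].
  - replace (f 0 - f 0 - l * 0) with 0 by ring. rewrite Rabs_R0. lra.
  - specialize (Hd h n Hh). rewrite Rplus_0_l in Hd.
    replace (f h - f 0 - l * h) with (((f h - f 0) / h - l) * h) by (field; auto).
    rewrite Rabs_mult. apply Rmult_le_compat_r; [apply Rabs_pos|lra].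
Qed.

(** The derivative is computed at the origin only, from the real derivatives of exp, cos and sin at
    0; the functional equation then moves it to every point. *)
Lemma Cderiv_Cexp_0 : Cderiv Cexp 0 1.
Proof.
  apply Cderiv_littleo. intros eps He.
  (* The real and imaginary parts of the remainder split into three terms each, all at most e * m;
     eps / 8 therefore suffices for the six, and e <= 1 tames the products. *)
  set (e := Rmin (eps / 8) 1).
  assert (e0 : 0 < e) by (apply Rmin_glb_lt; lra).
  assert (e1 : e <= 1) by apply Rmin_r. assert (e2 : e <= eps / 8) by apply Rmin_l.
  destruct (derivable_littleo exp (exp 0) (derivable_pt_lim_exp 0) e e0) as [d1 [Hd1 D1]].
  destruct (derivable_littleo cos (- sin 0) (derivable_pt_lim_cos 0) e e0) as [d2 [Hd2 D2]].
  destruct (derivable_littleo sin (cos 0) (derivable_pt_lim_sin 0) e e0) as [d3 [Hd3 D3]].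
  apply locally_Cmod. exists (Rmin (Rmin d1 d2) (Rmin d3 (e / 2))). split.
  { repeat apply Rmin_glb_lt; lra. }
  intros [x y] Hw. rewrite Cexp_0.
  replace ((x, y) - 0)%C with ((x, y) : C) in * by (unfold Cminus, Cplus, Copp, RtoC; simpl; f_equal; ring).
  assert (M1 := Rmin_l (Rmin d1 d2) (Rmin d3 (e / 2))).
  assert (M2 := Rmin_r (Rmin d1 d2) (Rmin d3 (e / 2))).
  assert (M3 := Rmin_l d1 d2). assert (M4 := Rmin_r d1 d2).
  assert (M5 := Rmin_l d3 (e / 2)). assert (M6 := Rmin_r d3 (e / 2)).
  assert (X := re_le_Cmod (x, y)). assert (Y := im_le_Cmod (x, y)). simpl in X, Y.
  specialize (D1 x ltac:(lra)). specialize (D2 y ltac:(lra)). specialize (D3 y ltac:(lra)).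
  rewrite exp_0 in D1. rewrite cos_0, sin_0 in D2. rewrite sin_0, cos_0 in D3.
  set (m := Cmod (x, y)) in *.
  assert (Hx : Rabs x < e / 2) by lra.
  replace (cos y - 1 - - 0 * y) with (cos y - 1) in D2 by ring.
  replace (sin y - 0 - 1 * y) with (sin y - y) in D3 by ring.
  eapply Rle_trans; [apply Cmod_le_abs|]. simpl.
  replace (exp x * cos y + - (1) + - (1 * x - 0 * y))
    with ((exp x - 1) * (cos y - 1) + (cos y - 1) + (exp x - 1 - 1 * x)) by ring.
  replace (exp x * sin y + - 0 + - (1 * y + 0 * x))
    with ((exp x - 1) * (sin y - y) + (exp x - 1) * y + (sin y - y)) by ring.
  assert (E1 : Rabs (exp x - 1) <= e).
  { replace (exp x - 1) with ((exp x - 1 - 1 * x) + x) by ring.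
    eapply Rle_trans; [apply Rabs_triang|]. assert (P := Rabs_pos x). nra. }
  assert (T1 := Rabs_triang ((exp x - 1) * (cos y - 1) + (cos y - 1)) (exp x - 1 - 1 * x)).
  assert (T2 := Rabs_triang ((exp x - 1) * (cos y - 1)) (cos y - 1)).
  assert (T3 := Rabs_triang ((exp x - 1) * (sin y - y) + (exp x - 1) * y) (sin y - y)).
  assert (T4 := Rabs_triang ((exp x - 1) * (sin y - y)) ((exp x - 1) * y)).
  rewrite Rabs_mult in T2. rewrite !Rabs_mult in T4.
  assert (Hm : 0 <= m) by apply Cmod_ge_0.
  assert (P1 := Rabs_pos (exp x - 1)). assert (P2 := Rabs_pos (cos y - 1)).
  assert (P3 := Rabs_pos (sin y - y)). assert (P4 := Rabs_pos y).
  assert (Q1 : Rabs (cos y - 1) <= e * m) by nra.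
  assert (Q2 : Rabs (sin y - y) <= e * m) by nra.
  assert (Q3 : Rabs (exp x - 1 - 1 * x) <= e * m) by nra.
  assert (Q4 : Rabs (exp x - 1) * Rabs (cos y - 1) <= e * m) by nra.
  assert (Q5 : Rabs (exp x - 1) * Rabs (sin y - y) <= e * m) by nra.
  assert (Q6 : Rabs (exp x - 1) * Rabs y <= e * m) by nra.
  assert (Q7 : e * m <= eps / 8 * m) by nra. lra.
Qed.

Lemma Cderiv_shift (z w0 : C) : Cderiv (fun w => (w - z)%C) w0 1.
Proof.
  apply (Cderiv_eq _ _ (1 - 0)%C); [ring|].
  apply Cderiv_minus; [apply Cderiv_id|apply Cderiv_const].
Qed.

Lemma Cderiv_Cexp (z : C) : Cderiv Cexp z (Cexp z).
Proof.
  apply (Cderiv_ext (fun w => (Cexp z * Cexp (w - z))%C)).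
  { intros w. rewrite <- Cexp_plus. f_equal. ring. }
  apply (Cderiv_eq _ _ (0 * Cexp (z - z) + Cexp z * (1 * 1))%C); [ring|].
  apply (Cderiv_mult (fun _ => Cexp z) (fun w => Cexp (w - z)%C)); [apply Cderiv_const|].
  apply (Cderiv_comp (fun w => (w - z)%C) Cexp); [apply Cderiv_shift|].
  replace (z - z)%C with (RtoC 0) by ring. apply Cderiv_Cexp_0.
Qed.

(** * Integrals of complex functions of a real variable *)

Local Notation CRInt := (@RInt C_R_CompleteNormedModule).
Local Notation is_CRInt := (@is_RInt C_R_NormedModule).
Local Notation ex_CRInt := (@ex_RInt C_R_NormedModule).
Local Notation Rcont f x := (@continuous R_UniformSpace C_UniformSpace f x).

Lemma ex_CRInt_cont (f : R -> C) (a b : R) :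
  a <= b -> (forall x, a <= x <= b -> Rcont f x) -> ex_CRInt f a b.
Proof.
  intros Hab H. apply (@ex_RInt_continuous C_R_CompleteNormedModule).
  rewrite Rmin_left, Rmax_right by auto. exact H.
Qed.

Lemma CRInt_correct (f : R -> C) (a b : R) : ex_CRInt f a b -> is_CRInt f a b (CRInt f a b).
Proof. apply (@RInt_correct C_R_CompleteNormedModule). Qed.

Lemma CRInt_unique (f : R -> C) (a b : R) (l : C) : is_CRInt f a b l -> CRInt f a b = l.
Proof. apply (@is_RInt_unique C_R_CompleteNormedModule). Qed.

Lemma is_CRInt_plus (f g : R -> C) (a b : R) (k l : C) :
  is_CRInt f a b k -> is_CRInt g a b l -> is_CRInt (fun x => (f x + g x)%C) a b (k + l)%C.
Proof. apply (@is_RInt_plus C_R_NormedModule). Qed.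

(** A complex factor is not a scalar of the real module [C_R_NormedModule], so real and imaginary
    parts are integrated separately. *)
Lemma is_CRInt_scal (f : R -> C) (a b : R) (k l : C) :
  is_CRInt f a b l -> is_CRInt (fun x => (k * f x)%C) a b (k * l)%C.
Proof.
  intros H.
  assert (H1 := is_RInt_fct_extend_fst (U := R_NormedModule) (V := R_NormedModule) _ _ _ _ H).
  assert (H2 := is_RInt_fct_extend_snd (U := R_NormedModule) (V := R_NormedModule) _ _ _ _ H).
  apply (is_RInt_fct_extend_pair (U := R_NormedModule) (V := R_NormedModule)).
  - apply (is_RInt_minus (V := R_NormedModule)); apply (is_RInt_scal (V := R_NormedModule)); assumption.
  - apply (is_RInt_plus (V := R_NormedModule)); apply (is_RInt_scal (V := R_NormedModule)); assumption.
Qed.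

(** The bound is asked on the open interval only, because later it contains 1/x on a segment that
    ends at x = 0. Setting the integrand to zero at the endpoints makes the closed-interval estimate
    applicable. *)
Lemma CRInt_bound (f : R -> C) (a b M : R) : a <= b -> ex_CRInt f a b ->
  (forall x, a < x < b -> Cmod (f x) <= M) -> Cmod (CRInt f a b) <= M * (b - a).
Proof.
  intros Hab Hex HM.
  destruct (Req_dec a b) as [<-|n].
  { rewrite (@RInt_point C_R_CompleteNormedModule).
    change (Cmod 0 <= M * (a - a)). rewrite Cmod_0. lra. }
  assert (M0 : 0 <= M).
  { apply Rle_trans with (Cmod (f ((a + b) / 2))); [apply Cmod_ge_0|apply HM; lra]. }
  set (g := fun x => if Rlt_dec a x then if Rlt_dec x b then f x else 0%C else 0%C).
  assert (Hg : is_CRInt g a b (CRInt f a b)).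
  { apply (is_RInt_ext (V := C_R_NormedModule) f); [|now apply CRInt_correct].
    rewrite Rmin_left, Rmax_right by auto. intros x Hx. unfold g.
    destruct (Rlt_dec a x); [|lra]. destruct (Rlt_dec x b); [reflexivity|lra]. }
  rewrite Cmod_norm. replace (M * (b - a)) with (scal (b - a) M) by (unfold scal; simpl; unfold mult; simpl; ring).
  apply (norm_RInt_le (V := C_R_NormedModule) g (fun _ => M) a b); auto.
  - intros x _. change (norm (g x)) with (@norm R_AbsRing C_R_NormedModule (g x)). rewrite <- Cmod_norm. unfold g.
    destruct (Rlt_dec a x); [destruct (Rlt_dec x b)|]; [apply HM; lra| |]; rewrite Cmod_0; lra.
  - apply (is_RInt_const (V := R_NormedModule)).
Qed.

Lemma CRInt_Chasles (f : R -> C) (a b c : R) :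
  ex_CRInt f a b -> ex_CRInt f b c -> (CRInt f a b + CRInt f b c)%C = CRInt f a c.
Proof. apply (@RInt_Chasles C_R_CompleteNormedModule). Qed.

Lemma Ccont_h (f : C -> C) (x y : R) : Ccont f (x, y) -> Rcont (fun t => f (t, y)) x.
Proof.
  intros H. apply (continuous_comp (fun t : R => (t, y) : C_UniformSpace) f); [|exact H].
  apply (continuous_comp_2 (fun t : R => t) (fun _ => y) (fun u v : R => (u, v) : C_UniformSpace)).
  - apply continuous_id.
  - apply continuous_const.
  - apply (continuous_ext (fun z : C_UniformSpace => z)); [now intros []|apply continuous_id].
Qed.

Lemma Ccont_v (f : C -> C) (x y : R) : Ccont f (x, y) -> Rcont (fun t => f (x, t)) y.
Proof.
  intros H. apply (continuous_comp (fun t : R => (x, t) : C_UniformSpace) f); [|exact H].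
  apply (continuous_comp_2 (fun _ => x) (fun t : R => t) (fun u v : R => (u, v) : C_UniformSpace)).
  - apply continuous_const.
  - apply continuous_id.
  - apply (continuous_ext (fun z : C_UniformSpace => z)); [now intros []|apply continuous_id].
Qed.

(** * Contour integrals along the sides of a rectangle *)

Definition hint (f : C -> C) (a b y : R) : C := CRInt (fun x => f (x, y)) a b.
Definition vint (f : C -> C) (x c d : R) : C := CRInt (fun y => f (x, y)) c d.

(** The integral of f dw counterclockwise around [a, b] x [c, d]: bottom minus top, then right minus
    left with dw = i dy. *)
Definition rect_int (f : C -> C) (a b c d : R) : C :=
  (hint f a b c - hint f a b d + Ci * (vint f b c d - vint f a c d))%C.

(** * Goursat's theorem on rectangles *)

Definition hcont (f : C -> C) (a b y : R) : Prop := forall x, a <= x <= b -> Ccont f (x, y).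
Definition vcont (f : C -> C) (x c d : R) : Prop := forall y, c <= y <= d -> Ccont f (x, y).
(** Only the boundary is concerned, since the interior may contain a pole. *)
Definition bcont (f : C -> C) (a b c d : R) : Prop :=
  hcont f a b c /\ hcont f a b d /\ vcont f a c d /\ vcont f b c d.

Lemma ex_hint (f : C -> C) (a b y : R) : a <= b -> hcont f a b y -> ex_CRInt (fun x => f (x, y)) a b.
Proof. intros H K. apply ex_CRInt_cont; auto. intros x Hx. now apply Ccont_h, K. Qed.

Lemma ex_vint (f : C -> C) (x c d : R) : c <= d -> vcont f x c d -> ex_CRInt (fun y => f (x, y)) c d.
Proof. intros H K. apply ex_CRInt_cont; auto. intros y Hy. now apply Ccont_v, K. Qed.

Lemma hint_Chasles (f : C -> C) (a m b y : R) : a <= m <= b -> hcont f a b y ->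
  hint f a b y = (hint f a m y + hint f m b y)%C.
Proof.
  intros H K. symmetry. apply CRInt_Chasles; apply ex_hint; try lra; intros x Hx; apply K; lra.
Qed.

Lemma vint_Chasles (f : C -> C) (x c m d : R) : c <= m <= d -> vcont f x c d ->
  vint f x c d = (vint f x c m + vint f x m d)%C.
Proof.
  intros H K. symmetry. apply CRInt_Chasles; apply ex_vint; try lra; intros y Hy; apply K; lra.
Qed.

(** The cut is traversed twice in opposite directions, so its two integrals cancel; only the
    horizontal sides are really divided. *)
Lemma rect_split_v (f : C -> C) (a m b c d : R) : a <= m <= b ->
  hcont f a b c -> hcont f a b d ->
  rect_int f a b c d = (rect_int f a m c d + rect_int f m b c d)%C.
Proof.
  intros H K1 K2. unfold rect_int.
  rewrite (hint_Chasles f a m b c), (hint_Chasles f a m b d) by auto. ring.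
Qed.

Lemma rect_split_h (f : C -> C) (a b c m d : R) : c <= m <= d ->
  vcont f a c d -> vcont f b c d ->
  rect_int f a b c d = (rect_int f a b c m + rect_int f a b m d)%C.
Proof.
  intros H K1 K2. unfold rect_int.
  rewrite (vint_Chasles f a c m d), (vint_Chasles f b c m d) by auto. ring.
Qed.

Lemma hint_plus (f g : C -> C) (a b y : R) : a <= b -> hcont f a b y -> hcont g a b y ->
  hint (fun w => (f w + g w)%C) a b y = (hint f a b y + hint g a b y)%C.
Proof.
  intros H K1 K2. apply CRInt_unique.
  apply is_CRInt_plus; apply CRInt_correct; now apply ex_hint.
Qed.

Lemma vint_plus (f g : C -> C) (x c d : R) : c <= d -> vcont f x c d -> vcont g x c d ->
  vint (fun w => (f w + g w)%C) x c d = (vint f x c d + vint g x c d)%C.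
Proof.
  intros H K1 K2. apply CRInt_unique.
  apply is_CRInt_plus; apply CRInt_correct; now apply ex_vint.
Qed.

Lemma hint_scal (f : C -> C) (k : C) (a b y : R) : a <= b -> hcont f a b y ->
  hint (fun w => (k * f w)%C) a b y = (k * hint f a b y)%C.
Proof.
  intros H K. apply CRInt_unique. apply is_CRInt_scal, CRInt_correct. now apply ex_hint.
Qed.

Lemma vint_scal (f : C -> C) (k : C) (x c d : R) : c <= d -> vcont f x c d ->
  vint (fun w => (k * f w)%C) x c d = (k * vint f x c d)%C.
Proof.
  intros H K. apply CRInt_unique. apply is_CRInt_scal, CRInt_correct. now apply ex_vint.
Qed.

Lemma rect_plus (f g : C -> C) (a b c d : R) : a <= b -> c <= d ->
  bcont f a b c d -> bcont g a b c d ->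
  rect_int (fun w => (f w + g w)%C) a b c d = (rect_int f a b c d + rect_int g a b c d)%C.
Proof.
  intros H1 H2 (F1 & F2 & F3 & F4) (G1 & G2 & G3 & G4). unfold rect_int.
  rewrite !hint_plus, !vint_plus by auto. ring.
Qed.

Lemma rect_scal (f : C -> C) (k : C) (a b c d : R) : a <= b -> c <= d ->
  bcont f a b c d ->
  rect_int (fun w => (k * f w)%C) a b c d = (k * rect_int f a b c d)%C.
Proof.
  intros H1 H2 (F1 & F2 & F3 & F4). unfold rect_int.
  rewrite !hint_scal, !vint_scal by auto. ring.
Qed.

Lemma hint_ext (f g : C -> C) (a b y : R) : a <= b ->
  (forall x, a < x < b -> f (x, y) = g (x, y)) -> hint f a b y = hint g a b y.
Proof.
  intros H E. apply (RInt_ext (V := C_R_CompleteNormedModule)).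
  rewrite Rmin_left, Rmax_right by auto. exact E.
Qed.

Lemma vint_ext (f g : C -> C) (x c d : R) : c <= d ->
  (forall y, c < y < d -> f (x, y) = g (x, y)) -> vint f x c d = vint g x c d.
Proof.
  intros H E. apply (RInt_ext (V := C_R_CompleteNormedModule)).
  rewrite Rmin_left, Rmax_right by auto. exact E.
Qed.

Lemma rect_ext (f g : C -> C) (a b c d : R) : a <= b -> c <= d ->
  (forall w, f w = g w) -> rect_int f a b c d = rect_int g a b c d.
Proof.
  intros H1 H2 E. unfold rect_int.
  rewrite (hint_ext f g a b c), (hint_ext f g a b d), (vint_ext f g a c d), (vint_ext f g b c d);
    auto.
Qed.

Lemma hint_bound (f : C -> C) (a b y M : R) : a <= b -> hcont f a b y ->
  (forall x, a < x < b -> Cmod (f (x, y)) <= M) -> Cmod (hint f a b y) <= M * (b - a).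
Proof. intros. apply CRInt_bound; auto. now apply ex_hint. Qed.

Lemma vint_bound (f : C -> C) (x c d M : R) : c <= d -> vcont f x c d ->
  (forall y, c < y < d -> Cmod (f (x, y)) <= M) -> Cmod (vint f x c d) <= M * (d - c).
Proof. intros. apply CRInt_bound; auto. now apply ex_vint. Qed.

Lemma Cmod_minus_triangle (x y : C) : Cmod (x - y) <= Cmod x + Cmod y.
Proof. unfold Cminus. eapply Rle_trans; [apply Cmod_triangle|]. rewrite Cmod_opp. lra. Qed.

Lemma rect_bound (f : C -> C) (a b c d M : R) : a <= b -> c <= d ->
  bcont f a b c d ->
  (forall x y, a <= x <= b -> c <= y <= d -> (x = a \/ x = b \/ y = c \/ y = d) ->
     Cmod (f (x, y)) <= M) ->
  Cmod (rect_int f a b c d) <= 2 * M * ((b - a) + (d - c)).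
Proof.
  intros H1 H2 (F1 & F2 & F3 & F4) HM. unfold rect_int.
  assert (B1 := hint_bound f a b c M H1 F1 ltac:(intros; apply HM; lra)).
  assert (B2 := hint_bound f a b d M H1 F2 ltac:(intros; apply HM; lra)).
  assert (B3 := vint_bound f a c d M H2 F3 ltac:(intros; apply HM; lra)).
  assert (B4 := vint_bound f b c d M H2 F4 ltac:(intros; apply HM; lra)).
  eapply Rle_trans; [apply Cmod_triangle|]. rewrite Cmod_mult, Cmod_Ci.
  assert (T1 := Cmod_minus_triangle (hint f a b c) (hint f a b d)).
  assert (T2 := Cmod_minus_triangle (vint f b c d) (vint f a c d)). lra.
Qed.

Lemma is_RInt_id (a b : R) : is_RInt (fun x : R => x) a b ((b * b - a * a) / 2).
Proof.
  replace ((b * b - a * a) / 2) with (minus (b * b / 2) (a * a / 2)) by (unfold minus, plus, opp; simpl; field).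
  apply (is_RInt_derive (V := R_CompleteNormedModule) (fun x => x * x / 2)).
  - intros x _. auto_derive; auto. field.
  - intros x _. apply continuous_id.
Qed.

Lemma hint_id (a b y : R) : hint (fun w => w) a b y = ((b * b - a * a) / 2, (b - a) * y).
Proof.
  apply CRInt_unique. apply (is_RInt_fct_extend_pair (U := R_NormedModule) (V := R_NormedModule)); simpl.
  - apply is_RInt_id.
  - apply (is_RInt_const (V := R_NormedModule)).
Qed.

Lemma vint_id (x c d : R) : vint (fun w => w) x c d = ((d - c) * x, (d * d - c * c) / 2).
Proof.
  apply CRInt_unique. apply (is_RInt_fct_extend_pair (U := R_NormedModule) (V := R_NormedModule)); simpl.
  - apply (is_RInt_const (V := R_NormedModule)).
  - apply is_RInt_id.
Qed.

Lemma hint_const (k : C) (a b y : R) : hint (fun _ => k) a b y = ((b - a) * k)%C.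
Proof.
  apply CRInt_unique. destruct k as [u v].
  replace ((b - a) * (u, v))%C with ((b - a) * u, (b - a) * v)
    by (unfold Cmult, Cminus, Cplus, Copp; simpl; f_equal; ring).
  apply (is_RInt_fct_extend_pair (U := R_NormedModule) (V := R_NormedModule)); simpl;
  apply (is_RInt_const (V := R_NormedModule)).
Qed.

Lemma vint_const (k : C) (x c d : R) : vint (fun _ => k) x c d = ((d - c) * k)%C.
Proof. exact (hint_const k c d x). Qed.

Lemma bcont_all (f : C -> C) (a b c d : R) : a <= b -> c <= d ->
  (forall x y, a <= x <= b -> c <= y <= d -> Ccont f (x, y)) -> bcont f a b c d.
Proof. intros H1 H2 H. repeat split; intros x Hx; apply H; lra. Qed.

Lemma rect_affine (k l : C) (a b c d : R) : a <= b -> c <= d ->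
  rect_int (fun w => (k + l * w)%C) a b c d = 0.
Proof.
  intros H1 H2.
  assert (B : forall z, Ccont (fun _ => k) z) by (intros; apply Ccont_const).
  assert (B' : forall z, Ccont (fun w => w) z) by (intros; apply Ccont_id).
  assert (B'' : forall z, Ccont (fun w => (l * w)%C) z).
  { intros. apply Ccont_mult; auto. apply Ccont_const. }
  rewrite (rect_plus (fun _ => k) (fun w => (l * w)%C)) by (auto; apply bcont_all; auto).
  rewrite (rect_scal (fun w => w)) by (auto; apply bcont_all; auto).
  unfold rect_int. rewrite !hint_id, !vint_id, !hint_const, !vint_const.
  destruct l as [u v], k as [p q].
  unfold Cmult, Cminus, Cplus, Copp, Ci, RtoC; simpl; f_equal; field.
Qed.

(** An affine function integrates to zero, so it may be subtracted first. In Goursat's proof it is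
    the tangent at the limit point of the rectangles. *)
Lemma rect_affine_approx (f : C -> C) (k l : C) (a b c d M : R) : a <= b -> c <= d ->
  (forall x y, a <= x <= b -> c <= y <= d -> Ccont f (x, y)) ->
  (forall x y, a <= x <= b -> c <= y <= d -> Cmod (f (x, y) - (k + l * (x, y))) <= M) ->
  Cmod (rect_int f a b c d) <= 2 * M * ((b - a) + (d - c)).
Proof.
  intros H1 H2 Hf HM.
  assert (Ha : forall w, Ccont (fun w => (k + l * w)%C) w).
  { intros w. apply Ccont_plus; [apply Ccont_const|]. apply Ccont_mult; [apply Ccont_const|apply Ccont_id]. }
  assert (Hg : forall x y, a <= x <= b -> c <= y <= d -> Ccont (fun w => (f w - (k + l * w))%C) (x, y)).
  { intros x y Hx Hy. apply Ccont_plus; [now apply Hf|].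
    apply (Ccont_ext_loc (fun w => (- (1) * (k + l * w))%C)); [apply locally_all; intros; ring|].
    apply Ccont_mult; [apply Ccont_const|apply Ha]. }
  rewrite (rect_ext f (fun w => ((f w - (k + l * w)) + (k + l * w))%C)) by (auto; intros; ring).
  rewrite (rect_plus (fun w => (f w - (k + l * w))%C)) by (auto; apply bcont_all; auto).
  rewrite rect_affine by auto. rewrite Cplus_0_r.
  apply rect_bound; auto. now apply bcont_all.
Qed.

Lemma nested_intervals (a b : nat -> R) :
  (forall n, a n <= a (S n)) -> (forall n, b (S n) <= b n) -> (forall n, a n <= b n) ->
  exists x, forall n, a n <= x <= b n.
Proof.
  intros Ha Hb Hab.
  assert (Ma : forall n k, a n <= a (n + k)%nat).
  { intros n k. induction k as [|k IH]; [rewrite Nat.add_0_r; lra|].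
    rewrite Nat.add_succ_r. eapply Rle_trans; [exact IH|apply Ha]. }
  assert (Mb : forall n k, b (n + k)%nat <= b n).
  { intros n k. induction k as [|k IH]; [rewrite Nat.add_0_r; lra|].
    rewrite Nat.add_succ_r. eapply Rle_trans; [apply Hb|exact IH]. }
  assert (C0 : forall n m, a n <= b m).
  { intros n m. apply Rle_trans with (a (n + m)%nat); [apply Ma|].
    apply Rle_trans with (b (n + m)%nat); [apply Hab|]. rewrite Nat.add_comm. apply Mb. }
  destruct (completeness (fun y => exists n, y = a n)) as [x [Hx1 Hx2]].
  - exists (b 0%nat). intros y [n ->]. apply C0.
  - exists (a 0%nat). now exists 0%nat.
  - exists x. intros n. split; [apply Hx1; now exists n|].
    apply Hx2. intros y [m ->]. apply C0.
Qed.

Section Goursat.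

Variable f : C -> C.

Definition quarter (q : (R * R) * (R * R)) (i j : bool) : (R * R) * (R * R) :=
  let '((a, b), (c, d)) := q in
  ((if i then (a + b) / 2 else a, if i then b else (a + b) / 2),
   (if j then (c + d) / 2 else c, if j then d else (c + d) / 2)).

Definition qint (q : (R * R) * (R * R)) : C :=
  rect_int f (fst (fst q)) (snd (fst q)) (fst (snd q)) (snd (snd q)).

(** An explicit function, so that the nested rectangles can be defined by recursion. The last
    quarter needs no test: if the other three fall short of a quarter of the whole integral, it
    cannot. *)
Definition worst_quarter (q : (R * R) * (R * R)) : (R * R) * (R * R) :=
  let big i j := Rle_dec (Cmod (qint q) / 4) (Cmod (qint (quarter q i j))) in
  if big false false then quarter q false false else
  if big false true then quarter q false true else
  if big true false then quarter q true false else quarter q true true.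

Lemma worst_quarter_spec (q : (R * R) * (R * R)) : exists i j, worst_quarter q = quarter q i j.
Proof.
  unfold worst_quarter. repeat destruct Rle_dec; eauto.
Qed.

Lemma worst_quarter_big (a b c d : R) : a <= b -> c <= d ->
  (forall x y, a <= x <= b -> c <= y <= d -> Ccont f (x, y)) ->
  Cmod (qint ((a, b), (c, d))) / 4 <= Cmod (qint (worst_quarter ((a, b), (c, d)))).
Proof.
  intros H1 H2 Hf.
  assert (E : qint ((a, b), (c, d)) =
    (qint (quarter ((a, b), (c, d)) false false) + qint (quarter ((a, b), (c, d)) false true)
    + (qint (quarter ((a, b), (c, d)) true false) + qint (quarter ((a, b), (c, d)) true true)))%C).
  { unfold qint, quarter; simpl.
    rewrite (rect_split_v f a ((a + b) / 2) b c d) by (try lra; intros x Hx; apply Hf; lra).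
    rewrite (rect_split_h f a ((a + b) / 2) c ((c + d) / 2) d) by (try lra; intros x Hx; apply Hf; lra).
    rewrite (rect_split_h f ((a + b) / 2) b c ((c + d) / 2) d) by (try lra; intros x Hx; apply Hf; lra).
    reflexivity. }
  unfold worst_quarter.
  destruct Rle_dec as [|n1]; [lra|]. destruct Rle_dec as [|n2]; [lra|]. destruct Rle_dec as [|n3]; [lra|].
  rewrite E at 1.
  assert (T := Cmod_triangle (qint (quarter (a, b, (c, d)) false false) + qint (quarter (a, b, (c, d)) false true))
     (qint (quarter (a, b, (c, d)) true false) + qint (quarter (a, b, (c, d)) true true))).
  assert (T1 := Cmod_triangle (qint (quarter (a, b, (c, d)) false false)) (qint (quarter (a, b, (c, d)) false true))).
  assert (T2 := Cmod_triangle (qint (quarter (a, b, (c, d)) true false)) (qint (quarter (a, b, (c, d)) true true))).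
  rewrite <- E in T. rewrite <- E. lra.
Qed.

(** Bisection loses at most a factor 4 per step. The n-th rectangle has width plus height s / 2^n,
    so near the limit point differentiability bounds its integral by 2 eps s^2 / 4^n; the powers of
    4 cancel and eps is arbitrary. *)
Lemma Goursat (a b c d : R) : a <= b -> c <= d ->
  (forall x y, a <= x <= b -> c <= y <= d -> exists l, Cderiv f (x, y) l) ->
  rect_int f a b c d = 0.
Proof.
  intros H1 H2 Hf.
  assert (Hc : forall x y, a <= x <= b -> c <= y <= d -> Ccont f (x, y)).
  { intros x y Hx Hy. destruct (Hf x y Hx Hy) as [l Hl]. exact (Cderiv_cont _ _ _ Hl). }
  set (q := fix q n := match n with O => ((a, b), (c, d)) | S n => worst_quarter (q n) end).
  set (A := fun n => fst (fst (q n))). set (B := fun n => snd (fst (q n))).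
  set (C' := fun n => fst (snd (q n))). set (D := fun n => snd (snd (q n))).
  assert (Eq : forall n, q n = ((A n, B n), (C' n, D n))).
  { intros n. unfold A, B, C', D. now destruct (q n) as [[] []]. }
  assert (St : forall n, exists i j : bool,
     A (S n) = (if i then (A n + B n) / 2 else A n) /\
     B (S n) = (if i then B n else (A n + B n) / 2) /\
     C' (S n) = (if j then (C' n + D n) / 2 else C' n) /\
     D (S n) = (if j then D n else (C' n + D n) / 2)).
  { intros n. destruct (worst_quarter_spec (q n)) as [i [j E]]. exists i, j.
    unfold A, B, C', D. change (q (S n)) with (worst_quarter (q n)). rewrite E.
    unfold quarter. destruct (q n) as [[] []]. simpl. auto. }
  assert (W : forall n, B n - A n = (b - a) / 2 ^ n /\ D n - C' n = (d - c) / 2 ^ n).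
  { induction n as [|n [IH1 IH2]].
    - unfold A, B, C', D; simpl. lra.
    - destruct (St n) as [i [j (E1 & E2 & E3 & E4)]]. rewrite E1, E2, E3, E4.
      assert (0 < 2 ^ n) by (apply pow_lt; lra).
      replace ((b - a) / 2 ^ S n) with (((b - a) / 2 ^ n) / 2) by (simpl; field; lra).
      replace ((d - c) / 2 ^ S n) with (((d - c) / 2 ^ n) / 2) by (simpl; field; lra).
      destruct i, j; lra. }
  assert (Pw : forall n, 0 < 2 ^ n) by (intros; apply pow_lt; lra).
  assert (O : forall n, A n <= B n /\ C' n <= D n).
  { intros n. destruct (W n) as [W1 W2].
    assert (0 <= (b - a) / 2 ^ n) by (apply Rmult_le_pos; [lra|apply Rlt_le, Rinv_0_lt_compat, Pw]).
    assert (0 <= (d - c) / 2 ^ n) by (apply Rmult_le_pos; [lra|apply Rlt_le, Rinv_0_lt_compat, Pw]).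
    lra. }
  assert (Mo : forall n, A n <= A (S n) /\ B (S n) <= B n /\ C' n <= C' (S n) /\ D (S n) <= D n).
  { intros n. destruct (O n) as [O1 O2]. destruct (St n) as [i [j (E1 & E2 & E3 & E4)]].
    rewrite E1, E2, E3, E4. destruct i, j; lra. }
  assert (In : forall n, a <= A n /\ B n <= b /\ c <= C' n /\ D n <= d).
  { induction n as [|n IH]; [unfold A, B, C', D; simpl; lra|]. specialize (Mo n). lra. }
  assert (Big : forall n, Cmod (rect_int f a b c d) / 4 ^ n <= Cmod (qint (q n))).
  { induction n as [|n IH].
    - unfold qint; simpl. lra.
    - change (q (S n)) with (worst_quarter (q n)). rewrite (Eq n).
      assert (K := worst_quarter_big (A n) (B n) (C' n) (D n)). specialize (O n). specialize (In n).
      rewrite <- Eq in K |- *.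
      assert (0 < 4 ^ n) by (apply pow_lt; lra).
      replace (Cmod (rect_int f a b c d) / 4 ^ S n) with ((Cmod (rect_int f a b c d) / 4 ^ n) / 4) by (simpl; field; lra).
      eapply Rle_trans; [|apply K; try lra; intros; apply Hc; lra]. lra. }
  destruct (nested_intervals A B) as [x Hx].
  { intros; apply Mo. } { intros; apply Mo. } { intros; apply O. }
  destruct (nested_intervals C' D) as [y Hy].
  { intros; apply Mo. } { intros; apply Mo. } { intros; apply O. }
  assert (Ix := Hx 0%nat). assert (Iy := Hy 0%nat).
  change (A 0%nat) with a in Ix. change (B 0%nat) with b in Ix.
  change (C' 0%nat) with c in Iy. change (D 0%nat) with d in Iy.
  destruct (Hf x y Ix Iy) as [l Hl].
  set (s := (b - a) + (d - c)). assert (s0 : 0 <= s) by (unfold s; lra).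
  assert (Sm : forall eps, 0 < eps -> Cmod (rect_int f a b c d) <= eps * (2 * s * s)).
  { intros eps He. assert (L := littleo_Cderiv _ _ _ Hl eps He).
    apply locally_Cmod in L. destruct L as [del [Hdel L]].
    (* The aim is s / 2^n < del; s + 1 in the denominator covers the degenerate rectangle s = 0. *)
    destruct (pow_lt_1_zero (1 / 2) ltac:(rewrite Rabs_right; lra) (del / (s + 1)))
      as [n Hn].
    { apply Rmult_lt_0_compat; [lra|apply Rinv_0_lt_compat; lra]. }
    specialize (Hn n ltac:(lia)).
    rewrite Rabs_right in Hn by (apply Rle_ge, pow_le; lra).
    assert (Hp : (1 / 2) ^ n = / 2 ^ n) by (rewrite <- pow_inv; f_equal; lra).
    rewrite Hp in Hn.
    assert (Hsm : s / 2 ^ n < del).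
    { assert (P := Rinv_0_lt_compat _ (Pw n)).
      apply Rmult_lt_compat_r with (r := s + 1) in Hn; [|lra].
      replace (del / (s + 1) * (s + 1)) with del in Hn by (field; lra).
      unfold Rdiv. lra. }
    destruct (W n) as [W1 W2]. specialize (O n). specialize (In n). specialize (Hx n). specialize (Hy n).
    assert (Ws : (B n - A n) + (D n - C' n) = s / 2 ^ n).
    { rewrite W1, W2. unfold s. field. apply Rgt_not_eq, Pw. }
    assert (K : Cmod (qint (q n)) <= 2 * (eps * (s / 2 ^ n)) * (s / 2 ^ n)).
    { rewrite <- Ws at 2. unfold qint. fold (A n) (B n) (C' n) (D n).
      apply (rect_affine_approx f (f (x, y) - l * (x, y))%C l); try lra.
      - intros; apply Hc; lra.
      - intros u v Hu Hv.
        assert (Dist : Cmod ((u, v) - (x, y)) <= s / 2 ^ n).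
        { eapply Rle_trans; [apply Cmod_le_abs|]. simpl. rewrite <- Ws.
          apply Rplus_le_compat; apply Rabs_le; lra. }
        replace (f (u, v) - (f (x, y) - l * (x, y) + l * (u, v)))%C
          with (f (u, v) - f (x, y) - l * ((u, v) - (x, y)))%C by ring.
        eapply Rle_trans; [apply L; lra|]. apply Rmult_le_compat_l; lra. }
    specialize (Big n).
    assert (P4 : 4 ^ n = 2 ^ n * 2 ^ n) by (rewrite <- Rpow_mult_distr; f_equal; lra).
    assert (K2 := Rle_trans _ _ _ Big K).
    apply Rmult_le_compat_r with (r := 4 ^ n) in K2; [|rewrite P4; specialize (Pw n); nra].
    replace (Cmod (rect_int f a b c d) / 4 ^ n * 4 ^ n) with (Cmod (rect_int f a b c d)) in K2
      by (rewrite P4; specialize (Pw n); field; lra).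
    replace (2 * (eps * (s / 2 ^ n)) * (s / 2 ^ n) * 4 ^ n) with (eps * (2 * s * s)) in K2
      by (rewrite P4; specialize (Pw n); field; lra).
    exact K2. }
  apply Cmod_eq_0. apply Rle_antisym; [|apply Cmod_ge_0].
  apply Rnot_lt_le. intros Hpos.
  set (I := Cmod (rect_int f a b c d)) in *.
  assert (Hd : 0 < 2 * s * s + 1) by nra.
  assert (He : 0 < I / (2 * s * s + 1)) by (apply Rdiv_lt_0_compat; lra).
  specialize (Sm _ He).
  assert (E : I / (2 * s * s + 1) * (2 * s * s) = I - I / (2 * s * s + 1)) by (field; lra).
  lra.
Qed.

End Goursat.

(** * Residues *)

Lemma sq_plus_sq_neq0 (t r : R) : 0 < r -> t * t + r * r <> 0.
Proof. intros Hr. apply Rgt_not_eq. assert (H := Rle_0_sqr t). unfold Rsqr in H. nra. Qed.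

Lemma is_RInt_zero (a b : R) : is_RInt (fun _ : R => 0) a b 0.
Proof.
  assert (H : is_RInt (V := R_NormedModule) (fun _ => 0) a b ((b - a) * 0))
    by exact (is_RInt_const (V := R_NormedModule) a b 0).
  rewrite Rmult_0_r in H.
  exact H.
Qed.

(** The primitive 2 atan((x - p) / r) runs from -pi/2 to pi/2. The integrand is what two opposite
    sides of a square contribute jointly to the integral of 1/(w - z0). *)
Lemma is_RInt_cauchy_kernel (p r : R) : 0 < r ->
  is_RInt (fun x => 2 * r / ((x - p) * (x - p) + r * r)) (p - r) (p + r) PI.
Proof.
  intros Hr.
  replace PI with (minus (2 * atan ((p + r - p) / r)) (2 * atan ((p - r - p) / r))).
  2:{ replace ((p + r - p) / r) with 1 by (field; lra).
      replace ((p - r - p) / r) with (- (1)) by (field; lra).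
      rewrite atan_opp, atan_1. unfold minus, plus, opp; simpl. field. }
  apply (is_RInt_derive (V := R_CompleteNormedModule) (fun x => 2 * atan ((x - p) / r))).
  - intros x _. auto_derive; auto.
    unfold Rsqr. field. split; [now apply sq_plus_sq_neq0|lra].
  - intros x _. apply continuity_pt_filterlim.
    assert (H : derivable_pt (fun x => 2 * r / ((x - p) * (x - p) + r * r)) x).
    { apply ex_derive_Reals_0. auto_derive. now apply sq_plus_sq_neq0. }
    now apply derivable_continuous_pt.
Qed.

Lemma Cinv_cont (z0 w : C) : w <> z0 -> Ccont (fun w => / (w - z0))%C w.
Proof.
  intros H. apply Ccont_inv.
  - apply Ccont_plus; [apply Ccont_id|apply Ccont_const].
  - intros E. apply H. replace w with ((w - z0) + z0)%C by ring. rewrite E. ring.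
Qed.

Lemma pair_neq (x y p q : R) : x <> p \/ y <> q -> (x, y) <> (p, q) :> C.
Proof. intros [H|H] E; injection E; intros; auto. Qed.

Lemma rect_inv_square (p q r : R) : 0 < r ->
  rect_int (fun w => / (w - (p, q)))%C (p - r) (p + r) (q - r) (q + r) = (2 * PI * Ci)%C.
Proof.
  intros Hr. unfold rect_int.
  assert (C1 : forall x y, x <> p \/ y <> q -> Ccont (fun w => / (w - (p, q)))%C (x, y)).
  { intros. apply Cinv_cont, pair_neq. auto. }
  set (f := fun w : C => (/ (w - (p, q)))%C) in *.
  assert (H1 : (hint f (p - r) (p + r) (q - r) - hint f (p - r) (p + r) (q + r))%C = (0, PI)).
  { replace (hint f (p - r) (p + r) (q - r) - hint f (p - r) (p + r) (q + r))%C
      with (hint f (p - r) (p + r) (q - r) + - (1) * hint f (p - r) (p + r) (q + r))%C by ring.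
    transitivity (CRInt (fun x => f (x, q - r)%R + - (1) * f (x, q + r)%R)%C (p - r) (p + r)).
    - symmetry. apply CRInt_unique. apply is_CRInt_plus; [|apply is_CRInt_scal];
        apply CRInt_correct, ex_hint; try lra; intros x Hx; apply C1; lra.
    - apply CRInt_unique.
      apply (is_RInt_ext (V := C_R_NormedModule)
        (fun x => (0, 2 * r / ((x - p) * (x - p) + r * r)) : C)).
      + intros x _. unfold f, Cinv, Cminus, Cplus, Copp, Cmult; simpl.
        assert (K := sq_plus_sq_neq0 (x - p) r Hr).
        f_equal; field; match goal with |- ?e <> 0 => replace e with ((x - p) * (x - p) + r * r) by ring; exact K end.
      + apply (is_RInt_fct_extend_pair (U := R_NormedModule) (V := R_NormedModule)); simpl.
        * apply is_RInt_zero.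
        * now apply is_RInt_cauchy_kernel. }
  assert (H2 : (vint f (p + r) (q - r) (q + r) - vint f (p - r) (q - r) (q + r))%C = (PI, 0)).
  { replace (vint f (p + r) (q - r) (q + r) - vint f (p - r) (q - r) (q + r))%C
      with (vint f (p + r) (q - r) (q + r) + - (1) * vint f (p - r) (q - r) (q + r))%C by ring.
    transitivity (CRInt (fun y => f (p + r, y)%R + - (1) * f (p - r, y)%R)%C (q - r) (q + r)).
    - symmetry. apply CRInt_unique. apply is_CRInt_plus; [|apply is_CRInt_scal];
        apply CRInt_correct, ex_vint; try lra; intros x Hx; apply C1; lra.
    - apply CRInt_unique.
      apply (is_RInt_ext (V := C_R_NormedModule)
        (fun x => (2 * r / ((x - q) * (x - q) + r * r), 0) : C)).
      + intros x _. unfold f, Cinv, Cminus, Cplus, Copp, Cmult; simpl.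
        assert (K := sq_plus_sq_neq0 (x - q) r Hr).
        f_equal; field; match goal with |- ?e <> 0 => replace e with ((x - q) * (x - q) + r * r) by ring; exact K end.
      + apply (is_RInt_fct_extend_pair (U := R_NormedModule) (V := R_NormedModule)); simpl.
        * now apply is_RInt_cauchy_kernel.
        * apply is_RInt_zero. }
  rewrite H1, H2. unfold Ci, Cmult, Cplus, RtoC; simpl. f_equal; ring.
Qed.

(** Outside the square lie two full-height strips and two blocks above and below it, all free of the
    pole, so [Goursat] kills all four. *)
Lemma rect_shrink (F : C -> C) (a b c d p q r : R) : 0 < r ->
  a < p - r -> p + r < b -> c < q - r -> q + r < d ->
  (forall x y, a <= x <= b -> c <= y <= d -> x <> p \/ y <> q ->
     exists l, Cderiv F (x, y) l) ->
  rect_int F a b c d = rect_int F (p - r) (p + r) (q - r) (q + r).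
Proof.
  intros Hr H1 H2 H3 H4 HF.
  assert (Hc : forall x y, a <= x <= b -> c <= y <= d -> x <> p \/ y <> q -> Ccont F (x, y)).
  { intros x y Hx Hy Hn. destruct (HF x y Hx Hy Hn) as [l Hl]. exact (Cderiv_cont _ _ _ Hl). }
  rewrite (rect_split_v F a (p - r) b c d) by (try lra; intros x Hx; apply Hc; lra).
  rewrite (Goursat F a (p - r) c d) by (try lra; intros; apply HF; lra).
  rewrite (rect_split_v F (p - r) (p + r) b c d) by (try lra; intros x Hx; apply Hc; lra).
  rewrite (Goursat F (p + r) b c d) by (try lra; intros; apply HF; lra).
  rewrite (rect_split_h F (p - r) (p + r) c (q - r) d) by (try lra; intros x Hx; apply Hc; lra).
  rewrite (Goursat F (p - r) (p + r) c (q - r)) by (try lra; intros; apply HF; lra).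
  rewrite (rect_split_h F (p - r) (p + r) (q - r) (q + r) d) by (try lra; intros x Hx; apply Hc; lra).
  rewrite (Goursat F (p - r) (p + r) (q + r) d) by (try lra; intros; apply HF; lra).
  ring.
Qed.

Lemma Cmod_small_0 (z : C) (k : R) : (forall eps, 0 < eps -> Cmod z <= eps * k) -> z = 0%C.
Proof.
  intros H. apply Cmod_eq_0. apply Rle_antisym; [|apply Cmod_ge_0].
  apply Rnot_lt_le. intros Hpos.
  assert (Hk : 0 < Rabs k + 1) by (generalize (Rabs_pos k); lra).
  specialize (H (Cmod z / (Rabs k + 1)) ltac:(apply Rdiv_lt_0_compat; lra)).
  assert (E : Cmod z / (Rabs k + 1) * Rabs k = Cmod z - Cmod z / (Rabs k + 1)) by (field; lra).
  assert (0 < Cmod z / (Rabs k + 1)) by (apply Rdiv_lt_0_compat; lra).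
  assert (K := Rle_abs k). nra.
Qed.

(** [G] extends (w - z0) F(w) continuously, so its value at z0 is the residue of a simple pole. On a
    small square of half-side r the difference F - G(z0) / (w - z0) is at most eps / r, and the
    perimeter is 8 r. *)
Lemma residue (F G : C -> C) (a b c d p q : R) :
  a < p < b -> c < q < d ->
  (forall x y, a <= x <= b -> c <= y <= d -> x <> p \/ y <> q ->
     exists l, Cderiv F (x, y) l) ->
  Ccont G (p, q) ->
  locally ((p, q) : C) (fun w => w <> (p, q) -> (F w * (w - (p, q)))%C = G w) ->
  rect_int F a b c d = (2 * PI * Ci * G (p, q))%C.
Proof.
  intros Hp Hq HF HG Hloc.
  set (z0 := (p, q) : C) in *. set (k := G z0) in *.
  set (inv := fun w : C => (/ (w - z0))%C).
  assert (Hinv : forall x y, x <> p \/ y <> q -> Ccont inv (x, y)).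
  { intros. apply Cinv_cont. now apply pair_neq. }
  enough (E : (rect_int F a b c d - 2 * PI * Ci * k)%C = 0%C).
  { replace (rect_int F a b c d) with ((rect_int F a b c d - 2 * PI * Ci * k) + 2 * PI * Ci * k)%C by ring.
    rewrite E. ring. }
  apply (Cmod_small_0 _ 8). intros eps He.
  assert (L := locally_and _ _ _ Hloc (proj1 (Ccont_eps G z0) HG eps He)).
  apply locally_Cmod in L. destruct L as [del [Hdel L]].
  (* The corners are within 2 r < del of z0, and halving the gaps keeps the square strictly inside
     the rectangle. *)
  set (r := Rmin (del / 4) (Rmin (Rmin ((p - a) / 2) ((b - p) / 2)) (Rmin ((q - c) / 2) ((d - q) / 2)))).
  assert (Hr : 0 < r) by (unfold r; repeat apply Rmin_glb_lt; lra).
  assert (R1 : r <= del / 4) by apply Rmin_l.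
  assert (R2 : r <= Rmin (Rmin ((p - a) / 2) ((b - p) / 2)) (Rmin ((q - c) / 2) ((d - q) / 2))) by apply Rmin_r.
  assert (R3 := Rle_trans _ _ _ R2 (Rmin_l _ _)). assert (R4 := Rle_trans _ _ _ R2 (Rmin_r _ _)).
  assert (R5 := Rle_trans _ _ _ R3 (Rmin_l _ _)). assert (R6 := Rle_trans _ _ _ R3 (Rmin_r _ _)).
  assert (R7 := Rle_trans _ _ _ R4 (Rmin_l _ _)). assert (R8 := Rle_trans _ _ _ R4 (Rmin_r _ _)).
  clear R2 R3 R4.
  rewrite (rect_shrink F a b c d p q r) by (try lra; auto).
  rewrite <- (rect_inv_square p q r Hr). fold z0. fold inv.
  assert (BF : bcont F (p - r) (p + r) (q - r) (q + r)).
  { repeat split; intros x Hx; (edestruct HF as [l Hl]; [| | |exact (Cderiv_cont _ _ _ Hl)]; lra). }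
  assert (BI : bcont inv (p - r) (p + r) (q - r) (q + r)).
  { repeat split; intros x Hx; apply Hinv; lra. }
  assert (BI' : bcont (fun w => (- k * inv w)%C) (p - r) (p + r) (q - r) (q + r)).
  { destruct BI as (B1 & B2 & B3 & B4).
    repeat split; intros x Hx; (apply Ccont_mult; [apply Ccont_const|]); auto. }
  replace (rect_int F (p - r) (p + r) (q - r) (q + r) - rect_int inv (p - r) (p + r) (q - r) (q + r) * k)%C
    with (rect_int F (p - r) (p + r) (q - r) (q + r) + - k * rect_int inv (p - r) (p + r) (q - r) (q + r))%C by ring.
  rewrite <- rect_scal by (auto; lra). rewrite <- rect_plus by (auto; lra).
  replace (eps * 8) with (2 * (eps / r) * ((p + r - (p - r)) + (q + r - (q - r)))) by (field; lra).
  apply rect_bound; try lra.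
  - destruct BF as (B1 & B2 & B3 & B4). destruct BI' as (A1 & A2 & A3 & A4).
    repeat split; intros x Hx; apply Ccont_plus; auto.
  - intros x y Hx Hy Hbd.
    assert (Hne : (x, y) <> z0 :> C) by (apply pair_neq; lra).
    assert (Hne' : ((x, y) - z0)%C <> 0%C).
    { intros E. apply Hne. replace ((x, y) : C) with (((x, y) - z0) + z0)%C by ring. rewrite E. ring. }
    assert (Lo : r <= Cmod ((x, y) - z0)).
    { destruct Hbd as [E|[E|[E|E]]].
      1,2: eapply Rle_trans; [|apply re_le_Cmod]; simpl; rewrite E.
      3,4: eapply Rle_trans; [|apply im_le_Cmod]; simpl; rewrite E.
      1,3: rewrite Rabs_left; lra. all: rewrite Rabs_right; lra. }
    assert (Up : Cmod ((x, y) - z0) < del).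
    { eapply Rle_lt_trans; [apply Cmod_le_abs|]. simpl.
      assert (Rabs (x + - p) <= r) by (apply Rabs_le; lra).
      assert (Rabs (y + - q) <= r) by (apply Rabs_le; lra). lra. }
    destruct (L _ Up) as [L1 L2]. specialize (L1 Hne).
    replace (F (x, y) + - k * inv (x, y))%C with ((G (x, y) - k) / ((x, y) - z0))%C.
    2:{ rewrite <- L1. unfold inv. field. exact Hne'. }
    rewrite Cmod_div by exact Hne'.
    apply Rle_trans with (eps / Cmod ((x, y) - z0)).
    + apply Rmult_le_compat_r; [|unfold k; lra]. apply Rlt_le, Rinv_0_lt_compat; lra.
    + apply Rmult_le_compat_l; [lra|]. apply Rinv_le_contravar; lra.
Qed.

(** * Newman's contour argument *)

(** This is X^w (1 + w^2 / r^2) with [lx] = ln X. The factor 1/w is left out so that the kernel is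
    entire, with value 1 at the future pole. *)
Definition newman_kernel (lx r : R) (w : C) : C := (Cexp (lx * w) * (1 + w * w / (r * r)))%C.

Lemma Cderiv_newman_kernel (lx r : R) (w : C) : exists l, Cderiv (newman_kernel lx r) w l.
Proof.
  eexists. unfold newman_kernel.
  apply (Cderiv_mult (fun w => Cexp (lx * w)%C) (fun w => (1 + w * w / (r * r))%C)).
  - apply (Cderiv_comp (fun w => (lx * w)%C) Cexp); [|apply Cderiv_Cexp].
    apply (Cderiv_mult (fun _ => RtoC lx) (fun w => w)); [apply Cderiv_const|apply Cderiv_id].
  - apply (Cderiv_plus (fun _ => 1%C) (fun w => (w * w / (r * r))%C)); [apply Cderiv_const|].
    apply (Cderiv_mult (fun w => (w * w)%C) (fun _ => (/ (r * r))%C)); [|apply Cderiv_const].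
    apply (Cderiv_mult (fun w => w) (fun w => w)); apply Cderiv_id.
Qed.

Lemma Cmod_newman_kernel (lx r x y : R) : 0 < r ->
  Cmod (newman_kernel lx r (x, y)) =
  exp (lx * x) * (Cmod (r * r + x * x - y * y, 2 * x * y) / (r * r)).
Proof.
  intros Hr. unfold newman_kernel. rewrite Cmod_mult, Cmod_Cexp. f_equal.
  - f_equal. simpl. ring.
  - assert (Hrr : 0 < r * r) by nra.
    replace (1 + (x, y) * (x, y) / (r * r))%C
      with (((r * r + x * x - y * y)%R, (2 * x * y)%R) / RtoC (r * r)%R)%C.
    2:{ unfold Cdiv. rewrite <- RtoC_mult, <- RtoC_inv by lra.
        unfold Cmult, Cplus, RtoC; simpl; f_equal; field; lra. }
    rewrite Cmod_div by (intros E; injection E; lra).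
    rewrite Cmod_R, Rabs_right by lra. reflexivity.
Qed.

(* On the horizontal sides the factor 1 + w^2/r^2 vanishes as Re w -> 0, which
   compensates the singularity 1 / Re w of the bounds for g - S and for S. *)
Lemma newman_kernel_top (lx r x y : R) : 0 < r -> Rabs x <= r -> y = r \/ y = - r ->
  Cmod (newman_kernel lx r (x, y) / (x, y)) <= exp (lx * x) * (3 * Rabs x / (r * r)).
Proof.
  intros Hr Hx Hy.
  assert (Hyy : y * y = r * r) by (destruct Hy; subst; ring).
  assert (Ha : Rabs y = r) by (destruct Hy; subst; [|rewrite Rabs_Ropp]; apply Rabs_right; lra).
  assert (Hw : r <= Cmod (x, y)) by (rewrite <- Ha; apply (im_le_Cmod (x, y))).
  rewrite Cmod_div by (apply Cmod_gt_0; lra).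
  rewrite Cmod_newman_kernel by auto.
  assert (B : Cmod (r * r + x * x - y * y, 2 * x * y) <= 3 * Rabs x * r).
  { eapply Rle_trans; [apply Cmod_le_abs|]. simpl. rewrite Hyy.
    replace (r * r + x * x - r * r) with (x * x) by ring.
    rewrite !Rabs_mult, Ha, (Rabs_right 2) by lra. generalize (Rabs_pos x); nra. }
  set (N := Cmod (r * r + x * x - y * y, 2 * x * y)) in *. set (M := Cmod (x, y)) in *.
  replace (exp (lx * x) * (N / (r * r)) / M) with (exp (lx * x) * (N * (/ (r * r) * / M)))
    by (unfold Rdiv; ring).
  apply Rmult_le_compat_l; [apply Rlt_le, exp_pos|].
  assert (Hi : / M <= / r) by (apply Rinv_le_contravar; lra).
  assert (Hi0 : 0 < / M) by (apply Rinv_0_lt_compat; lra).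
  assert (Hr2 : 0 < / (r * r)) by (apply Rinv_0_lt_compat; nra).
  apply Rle_trans with ((3 * Rabs x * r) * (/ (r * r) * / r)).
  - apply Rmult_le_compat; try assumption.
    + apply Cmod_ge_0.
    + apply Rmult_le_pos; lra.
    + apply Rmult_le_compat_l; lra.
  - apply Req_le. field. lra.
Qed.

(** On vertical sides |w| >= e, and |w|^2 <= 2 r^2 makes 1 + w^2 / r^2 at most 3 in modulus; here e
    will be b or r. *)
Lemma newman_kernel_side (lx r x y e : R) : 0 < e -> e <= r -> Rabs x = e -> Rabs y <= r ->
  Cmod (newman_kernel lx r (x, y) / (x, y)) <= exp (lx * x) * (3 / e).
Proof.
  intros He Her Hx Hy.
  assert (Hw : e <= Cmod (x, y)) by (rewrite <- Hx; apply (re_le_Cmod (x, y))).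
  rewrite Cmod_div by (apply Cmod_gt_0; lra).
  rewrite Cmod_newman_kernel by lra.
  assert (Hxx : x * x <= r * r).
  { rewrite <- (Rabs_right (x * x)) by nra. rewrite Rabs_mult, Hx. nra. }
  assert (Hyy : y * y <= r * r).
  { rewrite <- (Rabs_right (y * y)) by nra. rewrite Rabs_mult. generalize (Rabs_pos y); nra. }
  assert (B : Cmod (r * r + x * x - y * y, 2 * x * y) <= 3 * (r * r)).
  { assert (H := Cmod_sq (r * r + x * x - y * y, 2 * x * y)). simpl in H.
    assert (H0 := Cmod_ge_0 (r * r + x * x - y * y, 2 * x * y)).
    assert (U : 0 <= x * x) by nra. assert (V : 0 <= y * y) by nra.
    assert (Q : 0 < r * r) by nra.
    set (X := x * x) in *. set (Y := y * y) in *. set (Z := r * r) in *.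
    replace (2 * x * y * (2 * x * y)) with (4 * X * Y) in H by (unfold X, Y; ring).
    apply Rnot_lt_le. intros K. nra. }
  set (N := Cmod (r * r + x * x - y * y, 2 * x * y)) in *. set (M := Cmod (x, y)) in *.
  replace (exp (lx * x) * (N / (r * r)) / M) with (exp (lx * x) * (N * (/ (r * r) * / M)))
    by (unfold Rdiv; ring).
  apply Rmult_le_compat_l; [apply Rlt_le, exp_pos|].
  assert (Hi : / M <= / e) by (apply Rinv_le_contravar; lra).
  assert (Hi0 : 0 < / M) by (apply Rinv_0_lt_compat; lra).
  assert (Hr2 : 0 < / (r * r)) by (apply Rinv_0_lt_compat; nra).
  apply Rle_trans with ((3 * (r * r)) * (/ (r * r) * / e)).
  - apply Rmult_le_compat; try assumption.
    + apply Cmod_ge_0.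
    + apply Rmult_le_pos; lra.
    + apply Rmult_le_compat_l; lra.
  - apply Req_le. field. lra.
Qed.

Lemma Cmod_mult_le (x y : C) (a b : R) : Cmod x <= a -> Cmod y <= b -> Cmod (x * y) <= a * b.
Proof.
  intros. rewrite Cmod_mult. apply Rmult_le_compat; auto using Cmod_ge_0.
Qed.

(** The contour of S reaches to -r because S is entire, that of g only to -b. After the cancellation
    of 1/|x| each horizontal half-side gives 3/r and each vertical side 6/r, whence 12 = 3 + 3 + 6;
    for g the horizontal pieces have length b <= 1. [eps] allows for a truncation error, which the
    kernel multiplies by at most X^r on the right. *)
Lemma newman (g S : C -> C) (m m' eps G b r lx : R) :
  0 < b <= 1 -> 1 <= r -> 0 <= lx -> 0 <= m -> 0 <= m' -> 0 <= eps ->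
  (forall x y, - b <= x <= r -> - r <= y <= r -> exists l, Cderiv g (x, y) l) ->
  (forall w, exists l, Cderiv S w l) ->
  (forall x y, 0 < x <= r -> - r <= y <= r ->
     Cmod (g (x, y) - S (x, y)) <= m * exp (- (lx * x)) / x + eps) ->
  (forall x y, - b <= x < 0 -> - r <= y <= r -> Cmod (g (x, y)) <= G) ->
  (forall x y, - r <= x < 0 -> - r <= y <= r ->
     Cmod (S (x, y)) <= m' * exp (- (lx * x)) / (- x)) ->
  Cmod (g 0 - S 0) <=
    12 * m / r + 12 * m' / r + 6 * G / (r * r) + 6 * r * G * exp (- (b * lx)) / b
    + 12 * eps * exp (lx * r).
Proof.
  intros Hb Hr Hlx Hm Hm' Heps Dg DS Bgs Bg Bs.
  assert (G0 : 0 <= G).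
  { eapply Rle_trans; [apply Cmod_ge_0|apply (Bg (- b) 0); lra]. }
  set (K := newman_kernel lx r).
  set (F := fun (h : C -> C) (w : C) => (h w * (K w / w))%C).
  assert (DK := Cderiv_newman_kernel lx r). fold K in DK.
  assert (K0 : K 0%C = 1%C).
  { unfold K, newman_kernel. rewrite !Cmult_0_r, Cexp_0. unfold Cdiv. ring. }
  assert (DF : forall (h : C -> C) (w : C), w <> RtoC 0 -> (exists l, Cderiv h w l) -> exists l, Cderiv (F h) w l).
  { intros h w Hw [l Hl]. destruct (DK w) as [k Hk]. eexists.
    apply (Cderiv_mult h (fun w => (K w / w)%C)); [exact Hl|].
    apply (Cderiv_mult K (fun w => / w)%C); [exact Hk|].
    apply (Cderiv_inv (fun w => w)); [apply Cderiv_id|exact Hw]. }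
  assert (Cn0 : forall x y, x <> 0 \/ y <> 0 -> (x, y) <> 0%C :> C).
  { intros x y H. now apply pair_neq. }
  assert (CF : forall h x y, x <> 0 \/ y <> 0 -> (exists l, Cderiv h (x, y) l) -> Ccont (F h) (x, y)).
  { intros h x y H1 H2. destruct (DF h (x, y) (Cn0 x y H1) H2) as [l Hl]. exact (Cderiv_cont _ _ _ Hl). }
  assert (Res : forall h a, a < 0 ->
    (forall x y, a <= x <= r -> - r <= y <= r -> exists l, Cderiv h (x, y) l) ->
    rect_int (F h) a r (- r) r = (2 * PI * Ci * h 0)%C).
  { intros h a Ha Dh.
    rewrite (residue (F h) (fun w => (h w * K w)%C) a r (- r) r 0 0); try lra.
    - change ((0, 0) : C) with (RtoC 0). rewrite K0. ring.
    - intros x y Hx Hy Hn. apply DF; [now apply Cn0|now apply Dh].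
    - destruct (Dh 0 0 ltac:(lra) ltac:(lra)) as [l Hl]. destruct (DK (0, 0)) as [k Hk].
      apply Ccont_mult; [exact (Cderiv_cont _ _ _ Hl)|exact (Cderiv_cont _ _ _ Hk)].
    - apply locally_all. change ((0, 0) : C) with (RtoC 0). intros w Hw. unfold F. field. exact Hw. }
  assert (R1 := Res g (- b) ltac:(lra) Dg).
  assert (R2 := Res S (- r) ltac:(lra) (fun x y _ _ => DS (x, y))).
  assert (HF1 : forall a c y, - b <= a -> c <= r -> y = r \/ y = - r -> hcont (F g) a c y).
  { intros a c y Ha Hc Hy x Hx. apply CF; [right; lra|apply Dg; lra]. }
  assert (HF2 : forall a c y, y = r \/ y = - r -> hcont (F S) a c y).
  { intros a c y Hy x Hx. apply CF; [right; lra|apply DS]. }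
  unfold rect_int in R1, R2.
  (* The horizontal sides are cut at x = 0: to the right only the difference of g and S is small, to
     the left the two are estimated separately. *)
  rewrite (hint_Chasles (F g) (- b) 0 r (- r)) in R1 by (try apply HF1; lra).
  rewrite (hint_Chasles (F g) (- b) 0 r r) in R1 by (try apply HF1; lra).
  rewrite (hint_Chasles (F S) (- r) 0 r (- r)) in R2 by (try apply HF2; lra).
  rewrite (hint_Chasles (F S) (- r) 0 r r) in R2 by (try apply HF2; lra).
  set (D := fun w => (F g w + - (1) * F S w)%C).
  assert (ED : forall w, D w = ((g w - S w) * (K w / w))%C) by (intros; unfold D, F; ring).
  assert (HF2' : forall a c y, y = r \/ y = - r -> hcont (fun w => (- (1) * F S w)%C) a c y).
  { intros a c y Hy x Hx. apply Ccont_mult; [apply Ccont_const|]. now apply (HF2 a c y). }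
  assert (HD : forall y, y = r \/ y = - r ->
    hint (F g) 0 r y = (hint D 0 r y + hint (F S) 0 r y)%C).
  { intros y Hy. unfold D. rewrite hint_plus by (try apply HF1; try apply HF2'; auto; lra).
    rewrite hint_scal by (try apply HF2; auto; lra). ring. }
  assert (VF1 : vcont (F g) r (- r) r).
  { intros y Hy. apply CF; [left; lra|apply Dg; lra]. }
  assert (VFb : vcont (F g) (- b) (- r) r).
  { intros y Hy. apply CF; [left; lra|apply Dg; lra]. }
  assert (VF2 : forall x, x <> 0 -> vcont (F S) x (- r) r).
  { intros x Hx y Hy. apply CF; [left; lra|apply DS]. }
  assert (VF2' : vcont (fun w => (- (1) * F S w)%C) r (- r) r).
  { intros y Hy. apply Ccont_mult; [apply Ccont_const|]. apply VF2; lra. }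
  assert (VD : vint (F g) r (- r) r = (vint D r (- r) r + vint (F S) r (- r) r)%C).
  { unfold D. rewrite vint_plus by (auto; lra).
    rewrite vint_scal by (try apply VF2; lra). ring. }
  rewrite (HD r), (HD (- r)), VD in R1 by auto.
  assert (CD : forall y, y = r \/ y = - r -> hcont D 0 r y).
  { intros y Hy x Hx. apply Ccont_plus; [apply (HF1 0 r y)|apply (HF2' 0 r y)]; auto; lra. }
  assert (CVD : vcont D r (- r) r).
  { intros y Hy. apply Ccont_plus; [apply VF1|apply VF2']; auto. }
  assert (rr : 0 < r * r) by nra.
  assert (Ee : forall x, exp (- (lx * x)) * exp (lx * x) = 1).
  { intros x. rewrite <- exp_plus, Rplus_opp_l. apply exp_0. }
  assert (Emono : forall x y, x <= y -> exp x <= exp y).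
  { intros x y [H|H]; [left; now apply exp_increasing|rewrite H; lra]. }
  assert (B1 : forall y, y = r \/ y = - r ->
    Cmod (hint D 0 r y) <= (3 * m / (r * r) + 3 * eps * exp (lx * r) / r) * (r - 0)).
  { intros y Hy. apply hint_bound; [lra|auto|]. intros x Hx. rewrite ED.
    eapply Rle_trans.
    { apply Cmod_mult_le; [apply Bgs; lra|].
      apply newman_kernel_top; [lra| |exact Hy]. rewrite Rabs_right; lra. }
    rewrite Rabs_right by lra.
    (* Here 1/x meets the factor x from the zero of the kernel, and X^(-x) meets X^x. *)
    replace ((m * exp (- (lx * x)) / x + eps) * (exp (lx * x) * (3 * x / (r * r))))
      with (3 * m / (r * r) * (exp (- (lx * x)) * exp (lx * x)) + 3 * eps * exp (lx * x) / r * (x / r))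
      by (field; lra).
    rewrite Ee. apply Rplus_le_compat; [lra|].
    assert (X1 : exp (lx * x) <= exp (lx * r)) by (apply Emono; nra).
    assert (X2 : x / r <= 1).
    { apply Rmult_le_reg_r with r; [lra|]. unfold Rdiv. rewrite Rmult_assoc, Rinv_l; lra. }
    assert (X3 : 0 <= x / r) by (apply Rlt_le, Rdiv_lt_0_compat; lra).
    assert (X4 : 0 < exp (lx * x)) by apply exp_pos.
    assert (X5 : 0 < / r) by (apply Rinv_0_lt_compat; lra).
    rewrite <- (Rmult_1_r (3 * eps * exp (lx * r) / r)).
    apply Rmult_le_compat; try lra.
    - apply Rmult_le_pos; [|lra]. apply Rmult_le_pos; lra.
    - apply Rmult_le_compat_r; [lra|]. apply Rmult_le_compat_l; lra. }
  assert (B2 : Cmod (vint D r (- r) r) <= (3 * m / (r * r) + 3 * eps * exp (lx * r) / r) * (r - - r)).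
  { apply vint_bound; [lra|auto|]. intros y Hy. rewrite ED.
    eapply Rle_trans.
    { apply Cmod_mult_le; [apply Bgs; lra|].
      apply (newman_kernel_side lx r r y r); try lra; [apply Rabs_right; lra|apply Rabs_le; lra]. }
    replace ((m * exp (- (lx * r)) / r + eps) * (exp (lx * r) * (3 / r)))
      with (3 * m / (r * r) * (exp (- (lx * r)) * exp (lx * r)) + 3 * eps * exp (lx * r) / r)
      by (field; lra).
    rewrite Ee. lra. }
  assert (B3 : forall y, y = r \/ y = - r ->
    Cmod (hint (F g) (- b) 0 y) <= (3 * G / (r * r)) * (0 - - b)).
  { intros y Hy. apply hint_bound; [lra|apply HF1; auto; lra|]. intros x Hx. unfold F.
    eapply Rle_trans.
    { apply Cmod_mult_le; [apply Bg; lra|].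
      apply newman_kernel_top; [lra| |exact Hy]. rewrite Rabs_left; lra. }
    rewrite Rabs_left by lra.
    assert (X1 : exp (lx * x) <= 1) by (rewrite <- exp_0; apply Emono; nra).
    assert (X4 : 0 < exp (lx * x)) by apply exp_pos.
    assert (X5 : 0 < / (r * r)) by (apply Rinv_0_lt_compat; lra).
    replace (3 * G / (r * r)) with (G * (1 * (3 * 1 / (r * r)))) by (field; lra).
    apply Rmult_le_compat_l; [lra|].
    apply Rmult_le_compat; try lra.
    - apply Rmult_le_pos; lra.
    - apply Rmult_le_compat_r; lra. }
  assert (B4 : Cmod (vint (F g) (- b) (- r) r) <= (G * (exp (- (b * lx)) * (3 / b))) * (r - - r)).
  { apply vint_bound; [lra|auto|]. intros y Hy. unfold F.
    apply Cmod_mult_le; [apply Bg; lra|].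
    replace (- (b * lx)) with (lx * - b) by ring.
    apply newman_kernel_side; try lra; [rewrite Rabs_left; lra|apply Rabs_le; lra]. }
  assert (B5 : forall y, y = r \/ y = - r ->
    Cmod (hint (F S) (- r) 0 y) <= (3 * m' / (r * r)) * (0 - - r)).
  { intros y Hy. apply hint_bound; [lra|apply HF2; auto|]. intros x Hx. unfold F.
    eapply Rle_trans.
    { apply Cmod_mult_le; [apply Bs; lra|].
      apply newman_kernel_top; [lra| |exact Hy]. rewrite Rabs_left; lra. }
    rewrite Rabs_left by lra.
    replace (m' * exp (- (lx * x)) / - x * (exp (lx * x) * (3 * - x / (r * r))))
      with (3 * m' / (r * r) * (exp (- (lx * x)) * exp (lx * x))) by (field; lra).
    rewrite Ee. lra. }
  assert (B6 : Cmod (vint (F S) (- r) (- r) r) <= (3 * m' / (r * r)) * (r - - r)).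
  { apply vint_bound; [lra|apply VF2; lra|]. intros y Hy. unfold F.
    eapply Rle_trans.
    { apply Cmod_mult_le; [apply Bs; lra|].
      apply (newman_kernel_side lx r (- r) y r); try lra; [rewrite Rabs_left; lra|apply Rabs_le; lra]. }
    replace (m' * exp (- (lx * - r)) / - - r * (exp (lx * - r) * (3 / r)))
      with (3 * m' / (r * r) * (exp (- (lx * - r)) * exp (lx * - r))) by (field; lra).
    rewrite Ee. lra. }
  assert (E : (2 * PI * Ci * (g 0 - S 0) =
     (hint D 0 r (- r) - hint D 0 r r + Ci * vint D r (- r) r)
     + (hint (F g) (- b) 0 (- r) - hint (F g) (- b) 0 r - Ci * vint (F g) (- b) (- r) r)
     - (hint (F S) (- r) 0 (- r) - hint (F S) (- r) 0 r - Ci * vint (F S) (- r) (- r) r))%C).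
  { replace (2 * PI * Ci * (g 0 - S 0))%C with (2 * PI * Ci * g 0 - 2 * PI * Ci * S 0)%C by ring.
    rewrite <- R1, <- R2. ring. }
  assert (M : Cmod (2 * PI * Ci * (g 0 - S 0))%C = 2 * PI * Cmod (g 0 - S 0)%C).
  { rewrite !Cmod_mult, Cmod_Ci, !Cmod_R, (Rabs_right 2), (Rabs_right PI); try lra.
    generalize PI_RGT_0; lra. }
  assert (T : 2 * PI * Cmod (g 0 - S 0)%C <=
     (Cmod (hint D 0 r (- r)) + Cmod (hint D 0 r r) + Cmod (vint D r (- r) r))
     + (Cmod (hint (F g) (- b) 0 (- r)) + Cmod (hint (F g) (- b) 0 r) + Cmod (vint (F g) (- b) (- r) r))
     + (Cmod (hint (F S) (- r) 0 (- r)) + Cmod (hint (F S) (- r) 0 r) + Cmod (vint (F S) (- r) (- r) r))).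
  { rewrite <- M, E.
    assert (Ti : forall z, Cmod (Ci * z) = Cmod z) by (intros; rewrite Cmod_mult, Cmod_Ci; ring).
    eapply Rle_trans; [apply Cmod_minus_triangle|]. apply Rplus_le_compat.
    eapply Rle_trans; [apply Cmod_triangle|]. apply Rplus_le_compat.
    - eapply Rle_trans; [apply Cmod_triangle|]. rewrite Ti. apply Rplus_le_compat_r, Cmod_minus_triangle.
    - eapply Rle_trans; [apply Cmod_minus_triangle|]. rewrite Ti. apply Rplus_le_compat_r, Cmod_minus_triangle.
    - eapply Rle_trans; [apply Cmod_minus_triangle|]. rewrite Ti. apply Rplus_le_compat_r, Cmod_minus_triangle. }
  assert (B1a := B1 r ltac:(auto)). assert (B1b := B1 (- r) ltac:(auto)).
  assert (B3a := B3 r ltac:(auto)). assert (B3b := B3 (- r) ltac:(auto)).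
  assert (B5a := B5 r ltac:(auto)). assert (B5b := B5 (- r) ltac:(auto)).
  assert (Hpi := PI2_1).
  (* The factor 2 pi >= 1 is simply given away. *)
  assert (Z : Cmod (g 0 - S 0)%C <= 2 * PI * Cmod (g 0 - S 0)%C).
  { assert (Z0 := Cmod_ge_0 (g 0 - S 0)%C). nra. }
  eapply Rle_trans; [exact Z|]. eapply Rle_trans; [exact T|].
  assert (B3c : 3 * G / (r * r) * (0 - - b) <= 3 * G / (r * r)).
  { rewrite <- (Rmult_1_r (3 * G / (r * r))) at 2. apply Rmult_le_compat_l; [|lra].
    apply Rmult_le_pos; [lra|]. apply Rlt_le, Rinv_0_lt_compat; lra. }
  assert (Q1 : (3 * m / (r * r) + 3 * eps * exp (lx * r) / r) * (r - 0) = 3 * m / r + 3 * eps * exp (lx * r)) by (field; lra).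
  assert (Q2 : (3 * m / (r * r) + 3 * eps * exp (lx * r) / r) * (r - - r) = 6 * m / r + 6 * eps * exp (lx * r)) by (field; lra).
  assert (Q5 : 3 * m' / (r * r) * (0 - - r) = 3 * m' / r) by (field; lra).
  assert (Q6 : 3 * m' / (r * r) * (r - - r) = 6 * m' / r) by (field; lra).
  assert (Q4 : G * (exp (- (b * lx)) * (3 / b)) * (r - - r) = 6 * r * G * exp (- (b * lx)) / b) by (field; lra).
  rewrite Q1 in B1a, B1b. rewrite Q2 in B2. rewrite Q5 in B5a, B5b. rewrite Q6 in B6. rewrite Q4 in B4.
  lra.
Qed.

(** * A Borel-Caratheodory inequality *)

Lemma Re_le_Cmod (z : C) : Re z <= Cmod z.
Proof. eapply Rle_trans; [apply Rle_abs|apply re_le_Cmod]. Qed.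

(* Cauchy's estimate for the derivative of 1 / (f z0 + 2 u - f), which is
   bounded by 1 / u because Re f <= Re f z0 + u. *)
Lemma borel_caratheodory_deriv (f : C -> C) (p q h u : R) (l : C) : 0 < h -> 0 < u ->
  (forall x y, p - h <= x <= p + h -> q - h <= y <= q + h -> exists l, Cderiv f (x, y) l) ->
  (forall x y, p - h <= x <= p + h -> q - h <= y <= q + h -> Re (f (x, y)) <= Re (f (p, q)) + u) ->
  Cderiv f (p, q) l -> Cmod l <= 12 * u / h.
Proof.
  intros Hh Hu Df Bf Hl. set (z0 := (p, q) : C) in *.
  set (P := (f z0 + 2 * u)%C).
  set (g := fun w => (/ (P - f w))%C).
  assert (LP : forall x y, p - h <= x <= p + h -> q - h <= y <= q + h -> u <= Cmod (P - f (x, y))).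
  { intros x y Hx Hy. specialize (Bf x y Hx Hy).
    eapply Rle_trans; [|apply Re_le_Cmod]. unfold P. simpl. unfold Re in *. lra. }
  assert (NP : forall x y, p - h <= x <= p + h -> q - h <= y <= q + h -> (P - f (x, y))%C <> 0%C).
  { intros x y Hx Hy. apply Cmod_gt_0. specialize (LP x y Hx Hy). lra. }
  assert (Dg : forall x y k, p - h <= x <= p + h -> q - h <= y <= q + h -> Cderiv f (x, y) k ->
    Cderiv g (x, y) (- (0 - k) / ((P - f (x, y)) * (P - f (x, y))))).
  { intros x y k Hx Hy Hk. apply (Cderiv_inv (fun w => P - f w)%C); [|now apply NP].
    apply Cderiv_minus; [apply Cderiv_const|exact Hk]. }
  assert (Dg0 := Dg p q l ltac:(lra) ltac:(lra) Hl). fold z0 in Dg0.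
  assert (E0 : (P - f z0)%C = RtoC (2 * u)) by (unfold P; rewrite RtoC_mult; ring).
  rewrite E0 in Dg0.
  destruct Dg0 as [phi [Cphi [Ephi Lphi]]].
  (* This quotient has a simple pole at z0 with residue g'(z0), so [residue] yields Cauchy's formula
     for the derivative. *)
  set (F := fun w => ((g w - g z0) * / ((w - z0) * (w - z0)))%C).
  assert (Nz : forall w : C, w <> z0 -> (w - z0)%C <> 0%C).
  { intros w Hw E. apply Hw. replace w with ((w - z0) + z0)%C by ring. rewrite E. ring. }
  assert (DF : forall x y, p - h <= x <= p + h -> q - h <= y <= q + h -> x <> p \/ y <> q ->
    exists l, Cderiv F (x, y) l).
  { intros x y Hx Hy Hn. destruct (Df x y Hx Hy) as [k Hk]. eexists.
    apply (Cderiv_mult (fun w => g w - g z0)%C (fun w => / ((w - z0) * (w - z0)))%C).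
    - apply Cderiv_minus; [now apply Dg, Hk|apply Cderiv_const].
    - apply (Cderiv_inv (fun w => (w - z0) * (w - z0))%C).
      + apply Cderiv_mult; apply Cderiv_shift.
      + apply Cmult_neq_0; apply Nz; now apply pair_neq. }
  assert (R : rect_int F (p - h) (p + h) (q - h) (q + h) = (2 * PI * Ci * phi z0)%C).
  { apply residue; try lra; auto.
    revert Lphi. apply locally_imp. intros w Ew Hw. fold z0.
    unfold F. replace (g w - g z0)%C with ((w - z0) * phi w)%C by (rewrite Ew; ring).
    field. now apply Nz. }
  (* On the boundary |g - g(z0)| <= 1/u + 1/(2u) = 3/(2u) and |w - z0| >= h. *)
  assert (B : Cmod (rect_int F (p - h) (p + h) (q - h) (q + h))
     <= 2 * (3 / (2 * u) / (h * h)) * ((p + h - (p - h)) + (q + h - (q - h)))).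
  { apply rect_bound; try lra.
    - repeat split; intros x Hx; (edestruct DF as [k Hk]; [| | |exact (Cderiv_cont _ _ _ Hk)]; lra).
    - intros x y Hx Hy Hbd.
      assert (Lo : h <= Cmod ((x, y) - z0)).
      { destruct Hbd as [E|[E|[E|E]]].
        1,2: eapply Rle_trans; [|apply re_le_Cmod]; simpl; rewrite E.
        3,4: eapply Rle_trans; [|apply im_le_Cmod]; simpl; rewrite E.
        1,3: rewrite Rabs_left; lra. all: rewrite Rabs_right; lra. }
      assert (Hne : ((x, y) - z0)%C <> 0%C) by (apply Cmod_gt_0; lra).
      unfold F. unfold Rdiv at 1. apply Rle_trans with ((3 / (2 * u)) * / (h * h)); [|lra].
      rewrite Cmod_mult. apply Rmult_le_compat; try apply Cmod_ge_0.
      + eapply Rle_trans; [apply Cmod_minus_triangle|].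
        unfold g. rewrite E0, Cmod_inv, Cmod_inv.
        2: intros E; injection E; lra.
        2: now apply NP.
        rewrite Cmod_R, Rabs_right by lra.
        assert (/ Cmod (P - f (x, y)) <= / u) by (apply Rinv_le_contravar; [lra|now apply LP]).
        replace (3 / (2 * u)) with (/ u + / (2 * u)) by (field; lra). lra.
      + rewrite Cmod_inv by now apply Cmult_neq_0.
        apply Rinv_le_contravar; [nra|]. rewrite Cmod_mult. nra. }
  rewrite R, !Cmod_mult, Cmod_Ci, !Cmod_R, (Rabs_right 2), (Rabs_right PI) in B
    by (generalize PI_RGT_0; lra).
  rewrite Ephi in B. 
  assert (Eq : Cmod (- (0 - l) / (RtoC (2 * u) * RtoC (2 * u))) = Cmod l / (4 * u * u)).
  { replace (- (0 - l))%C with l by ring. rewrite Cmod_div, Cmod_mult, Cmod_R, Rabs_right by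
      (try lra; apply Cmult_neq_0; intros E; injection E; lra).
    field. lra. }
  rewrite Eq in B.
  (* [PI2_1] gives 2 pi >= 4, and this 4 cancels the one in g'(z0) = l / (4 u^2). *)
  assert (Hpi := PI2_1). assert (L0 := Cmod_ge_0 l).
  assert (K1 : 0 <= Cmod l / (4 * u * u)) by (apply Rmult_le_pos; [lra|apply Rlt_le, Rinv_0_lt_compat; nra]).
  assert (K2 : 4 * (Cmod l / (4 * u * u)) <= 12 / (u * h)).
  { replace (12 / (u * h)) with (2 * (3 / (2 * u) / (h * h)) * ((p + h - (p - h)) + (q + h - (q - h))))
      by (field; lra). nra. }
  apply Rmult_le_compat_r with (r := u * u) in K2; [|nra].
  replace (4 * (Cmod l / (4 * u * u)) * (u * u)) with (Cmod l) in K2 by (field; lra).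
  replace (12 / (u * h) * (u * u)) with (12 * u / h) in K2 by (field; lra). exact K2.
Qed.

(** Restricting to a horizontal line allows the real mean value theorem to be applied to Re f and Im
    f. *)
Lemma Cderiv_partial (f : C -> C) (x y : R) (l : C) : Cderiv f (x, y) l ->
  derivable_pt_lim (fun t => Re (f (t, y))) x (Re l) /\
  derivable_pt_lim (fun t => Im (f (t, y))) x (Im l).
Proof.
  intros H.
  assert (K : forall eps, 0 < eps -> exists d : posreal, forall h, h <> 0 -> Rabs h < d ->
    Cmod (f (x + h, y)%R - f (x, y) - h * l) <= eps / 2 * Rabs h).
  { intros eps He. assert (L := littleo_Cderiv _ _ _ H (eps / 2) ltac:(lra)).
    apply locally_Cmod in L. destruct L as [d [Hd L]]. exists (mkposreal d Hd).
    intros h Hh Hhd.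
    assert (E : ((x + h, y)%R - (x, y))%C = RtoC h).
    { unfold Cminus, Cplus, Copp, RtoC; simpl. f_equal; ring. }
    specialize (L (x + h, y)). rewrite E, Cmod_R in L. specialize (L Hhd).
    replace (h * l)%C with (l * h)%C by ring. exact L. }
  split; intros eps He; destruct (K eps He) as [d Kd]; exists d; intros h Hh Hhd; specialize (Kd h Hh Hhd).
  - assert (J := Rle_trans _ _ _ (re_le_Cmod _) Kd).
    replace (Re (f (x + h, y)%R - f (x, y) - h * l)) with (Re (f (x + h, y)) - Re (f (x, y)) - h * Re l) in J
      by (simpl; unfold Re; ring).
    replace ((Re (f (x + h, y)) - Re (f (x, y))) / h - Re l)
      with ((Re (f (x + h, y)) - Re (f (x, y)) - h * Re l) / h) by (field; auto).
    unfold Rdiv at 1. rewrite Rabs_mult, Rabs_inv.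
    assert (P := Rabs_pos_lt h Hh).
    apply Rmult_le_compat_r with (r := / Rabs h) in J; [|apply Rlt_le, Rinv_0_lt_compat; lra].
    rewrite Rmult_assoc, Rinv_r in J by lra. lra.
  - assert (J := Rle_trans _ _ _ (im_le_Cmod _) Kd).
    replace (Im (f (x + h, y)%R - f (x, y) - h * l)) with (Im (f (x + h, y)) - Im (f (x, y)) - h * Im l) in J
      by (simpl; unfold Im; ring).
    replace ((Im (f (x + h, y)) - Im (f (x, y))) / h - Im l)
      with ((Im (f (x + h, y)) - Im (f (x, y)) - h * Im l) / h) by (field; auto).
    unfold Rdiv at 1. rewrite Rabs_mult, Rabs_inv.
    assert (P := Rabs_pos_lt h Hh).
    apply Rmult_le_compat_r with (r := / Rabs h) in J; [|apply Rlt_le, Rinv_0_lt_compat; lra].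
    rewrite Rmult_assoc, Rinv_r in J by lra. lra.
Qed.

Lemma mvt_bound (phi : R -> R) (a b M : R) : a <= b ->
  (forall x, a <= x <= b -> exists d, derivable_pt_lim phi x d /\ Rabs d <= M) ->
  Rabs (phi b - phi a) <= M * (b - a).
Proof.
  intros Hab H.
  destruct (MVT_gen phi a b (Derive phi)) as [c [Hc Ec]].
  - rewrite Rmin_left, Rmax_right by lra. intros y Hy.
    destruct (H y ltac:(lra)) as [d [Hd _]]. apply Derive_correct.
    exists d. now apply is_derive_Reals.
  - rewrite Rmin_left, Rmax_right by lra. intros y Hy.
    destruct (H y Hy) as [d [Hd _]]. apply derivable_continuous_pt. now exists d.
  - rewrite Rmin_left, Rmax_right in Hc by lra.
    destruct (H c Hc) as [d [Hd Bd]].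
    apply is_derive_Reals, is_derive_unique in Hd.
    rewrite Ec, Rabs_mult, Hd, (Rabs_right (b - a)) by lra.
    apply Rmult_le_compat_r; lra.
Qed.

(* With u = A - Re f > 0, the derivative estimate reads |f'| <= 12 u / h, so
   ln u, and hence f, varies by a bounded factor along the segment. *)
Lemma borel_caratheodory_segment (f : C -> C) (a b t h A : R) : 0 < h -> a < b ->
  (forall x y, a - h <= x <= b + h -> t - h <= y <= t + h -> exists l, Cderiv f (x, y) l) ->
  (forall x y, a - h <= x <= b + h -> t - h <= y <= t + h -> Re (f (x, y)) < A) ->
  Cmod (f (a, t)) <= Cmod (f (b, t)) +
    24 * (b - a) / h * exp (12 * (b - a) / h) * (A + Cmod (f (b, t))).
Proof.
  intros Hh Hab Df Bf.
  set (u := fun x => A - Re (f (x, t))).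
  assert (u0 : forall x, a <= x <= b -> 0 < u x).
  { intros x Hx. unfold u. specialize (Bf x t ltac:(lra) ltac:(lra)). lra. }
  assert (Dx : forall x, a <= x <= b -> forall l, Cderiv f (x, t) l -> Cmod l <= 12 * u x / h).
  { intros x Hx l Hl. apply (borel_caratheodory_deriv f x t h (u x) l); auto.
    - intros; apply Df; lra.
    - intros x' y' Hx' Hy'. unfold u. specialize (Bf x' y' ltac:(lra) ltac:(lra)). lra. }
  assert (Hlu : forall x, a <= x <= b -> u x <= u b * exp (12 * (b - a) / h)).
  { intros x Hx.
    assert (M : Rabs (ln (u b) - ln (u x)) <= 12 / h * (b - x)).
    { apply (mvt_bound (fun y => ln (u y))); [lra|]. intros y Hy.
      destruct (Df y t ltac:(lra) ltac:(lra)) as [l Hl].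
      specialize (Dx y ltac:(lra) l Hl). specialize (u0 y ltac:(lra)).
      exists (/ u y * (0 - Re l)). split.
      - apply (derivable_pt_lim_comp u ln); [|now apply derivable_pt_lim_ln].
        apply derivable_pt_lim_minus; [apply derivable_pt_lim_const|].
        apply (Cderiv_partial _ _ _ _ Hl).
      - rewrite Rabs_mult, Rabs_inv, (Rabs_right (u y)) by lra.
        replace (0 - Re l) with (- Re l) by ring. rewrite Rabs_Ropp.
        assert (J := Rle_trans _ _ _ (re_le_Cmod l) Dx).
        apply Rmult_le_reg_l with (u y); [lra|].
        rewrite <- Rmult_assoc, Rinv_r, Rmult_1_l by lra.
        replace (u y * (12 / h)) with (12 * u y / h) by (field; lra). exact J. }
    assert (ub := u0 b ltac:(lra)). assert (ux := u0 x Hx).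
    assert (N : ln (u x) <= ln (u b) + 12 * (b - a) / h).
    { apply Rabs_le_between in M.
      assert (Q : 12 / h * (b - x) <= 12 * (b - a) / h).
      { replace (12 * (b - a) / h) with (12 / h * (b - a)) by (field; lra).
        apply Rmult_le_compat_l; [|lra]. apply Rlt_le, Rdiv_lt_0_compat; lra. }
      lra. }
    rewrite <- (exp_ln (u x)), <- (exp_ln (u b)), <- exp_plus by lra.
    destruct N as [N|N]; [left; now apply exp_increasing|rewrite N; lra]. }
  set (U := 12 * (u b * exp (12 * (b - a) / h)) / h).
  assert (Bl : forall x l, a <= x <= b -> Cderiv f (x, t) l -> Cmod l <= U).
  { intros x l Hx Hl. eapply Rle_trans; [apply (Dx x Hx l Hl)|].
    apply Rmult_le_compat_r; [apply Rlt_le, Rinv_0_lt_compat; lra|].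
    specialize (Hlu x Hx). lra. }
  assert (M1 : Rabs (Re (f (b, t)) - Re (f (a, t))) <= U * (b - a)).
  { apply (mvt_bound (fun y => Re (f (y, t)))); [lra|]. intros y Hy.
    destruct (Df y t ltac:(lra) ltac:(lra)) as [l Hl]. exists (Re l).
    split; [apply (Cderiv_partial _ _ _ _ Hl)|].
    eapply Rle_trans; [apply re_le_Cmod|]. now apply (Bl y). }
  assert (M2 : Rabs (Im (f (b, t)) - Im (f (a, t))) <= U * (b - a)).
  { apply (mvt_bound (fun y => Im (f (y, t)))); [lra|]. intros y Hy.
    destruct (Df y t ltac:(lra) ltac:(lra)) as [l Hl]. exists (Im l).
    split; [apply (Cderiv_partial _ _ _ _ Hl)|].
    eapply Rle_trans; [apply im_le_Cmod|]. now apply (Bl y). }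
  (* The factor 2, and so 24 = 2 * 12 in the statement, comes from treating the real and imaginary
     parts separately. *)
  assert (D : Cmod (f (b, t) - f (a, t)) <= 2 * (U * (b - a))).
  { eapply Rle_trans; [apply Cmod_le_abs|].
    change (Rabs (Re (f (b, t)) - Re (f (a, t))) + Rabs (Im (f (b, t)) - Im (f (a, t)))
      <= 2 * (U * (b - a))). lra. }
  assert (ub : u b <= A + Cmod (f (b, t))).
  { unfold u. assert (J := re_le_Cmod (f (b, t))). apply Rabs_le_between in J. lra. }
  replace (f (a, t)) with (f (b, t) - (f (b, t) - f (a, t)))%C by ring.
  eapply Rle_trans; [apply Cmod_minus_triangle|].
  apply Rplus_le_compat_l. eapply Rle_trans; [exact D|].
  unfold U.
  replace (2 * (12 * (u b * exp (12 * (b - a) / h)) / h * (b - a)))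
    with (24 * (b - a) / h * exp (12 * (b - a) / h) * u b) by (field; lra).
  apply Rmult_le_compat_l; [|exact ub].
  apply Rmult_le_pos; [|apply Rlt_le, exp_pos]. apply Rmult_le_pos; [lra|].
  apply Rlt_le, Rinv_0_lt_compat; lra.
Qed.

(** * Finite sums, series and power sums *)

Fixpoint rsum (f : nat -> R) (n : nat) : R :=
  match n with O => 0 | S n => rsum f n + f n end.

Fixpoint csum (f : nat -> C) (n : nat) : C :=
  match n with O => RtoC 0 | S n => (csum f n + f n)%C end.

Lemma rsum_le (f g : nat -> R) (n : nat) :
  (forall k, (k < n)%nat -> f k <= g k) -> rsum f n <= rsum g n.
Proof.
  induction n as [|n IH]; intros H; simpl; [lra|].
  apply Rplus_le_compat; [apply IH; intros; apply H; lia|apply H; lia].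
Qed.

Lemma rsum_scal (k : R) (f : nat -> R) (n : nat) : rsum (fun i => k * f i) n = k * rsum f n.
Proof. induction n as [|n IH]; simpl; [ring|rewrite IH; ring]. Qed.

Lemma csum_ext (f g : nat -> C) (n : nat) :
  (forall k, (k < n)%nat -> f k = g k) -> csum f n = csum g n.
Proof.
  induction n as [|n IH]; intros H; simpl; [reflexivity|].
  rewrite IH, H by (try intros; try apply H; lia). reflexivity.
Qed.

Lemma csum_minus (f g : nat -> C) (n : nat) :
  csum (fun k => (f k - g k)%C) n = (csum f n - csum g n)%C.
Proof. induction n as [|n IH]; simpl; [ring|rewrite IH; ring]. Qed.

Lemma Cmod_csum_le (f : nat -> C) (b : nat -> R) (n : nat) :
  (forall k, (k < n)%nat -> Cmod (f k) <= b k) -> Cmod (csum f n) <= rsum b n.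
Proof.
  induction n as [|n IH]; intros H; simpl; [rewrite Cmod_0; lra|].
  eapply Rle_trans; [apply Cmod_triangle|].
  apply Rplus_le_compat; [apply IH; intros; apply H; lia|apply H; lia].
Qed.

Lemma csum_shift (f : nat -> C) (n k : nat) :
  csum f (n + k) = (csum f n + csum (fun i => f (n + i)%nat) k)%C.
Proof.
  induction k as [|k IH]; [rewrite Nat.add_0_r; simpl; ring|].
  rewrite Nat.add_succ_r. simpl. rewrite IH. ring.
Qed.

Lemma csum_S_first (f : nat -> C) (n : nat) :
  csum f (S n) = (f 0%nat + csum (fun i => f (S i)) n)%C.
Proof. change (S n) with (1 + n)%nat. rewrite csum_shift. simpl. ring. Qed.

Lemma Cderiv_csum (F : nat -> C -> C) (n : nat) (w : C) :
  (forall k, exists l, Cderiv (F k) w l) ->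
  exists l, Cderiv (fun w => csum (fun k => F k w) n) w l.
Proof.
  intros H. induction n as [|n [l IH]]; simpl.
  - exists 0%C. apply Cderiv_const.
  - destruct (H n) as [k Hk]. eexists.
    apply (Cderiv_plus (fun w => csum (fun k => F k w) n) (F n)); eassumption.
Qed.

Lemma iter_filter_csum (f : nat -> bool) (g : nat -> C) (n : nat) :
  Iter.iter Cplus (RtoC 0) (filter f (seq 0 n)) g = csum (fun k => if f k then g k else RtoC 0) n.
Proof.
  assert (App : forall l1 l2, Iter.iter Cplus (RtoC 0) (l1 ++ l2) g =
    (Iter.iter Cplus (RtoC 0) l1 g + Iter.iter Cplus (RtoC 0) l2 g)%C).
  { intros l1 l2. induction l1 as [|a l1 IH]; simpl; [ring|]. rewrite IH. ring. }
  induction n as [|n IH]; [reflexivity|].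
  rewrite seq_S, filter_app, App, IH. simpl. destruct (f n); simpl; ring.
Qed.

(** [sum_n] includes its upper index, [rsum] excludes it. *)
Lemma rsum_sum_n (a : nat -> R) (n : nat) : sum_n a n = rsum a (S n).
Proof.
  induction n as [|n IH]; [rewrite sum_O; simpl; ring|].
  rewrite sum_Sn, IH. reflexivity.
Qed.

Lemma csum_sum_n (a : nat -> C) (n : nat) :
  csum a (S n) = (sum_n (fun k => Re (a k)) n, sum_n (fun k => Im (a k)) n).
Proof.
  induction n as [|n IH].
  - rewrite !sum_O. simpl. destruct (a 0%nat). unfold Cplus, RtoC; simpl. f_equal; ring.
  - rewrite !sum_Sn. change (csum a (S (S n))) with (csum a (S n) + a (S n))%C. rewrite IH. reflexivity.
Qed.

Definition ex_CSeries (a : nat -> C) : Prop :=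
  ex_series (fun n => Re (a n)) /\ ex_series (fun n => Im (a n)).

Lemma ex_series_bounded (b : nat -> R) (B : R) :
  (forall n, 0 <= b n) -> (forall n, rsum b n <= B) -> ex_series b.
Proof.
  intros H0 HB.
  destruct (ex_finite_lim_seq_incr (sum_n b) B) as [l Hl].
  - intros n. rewrite sum_Sn. unfold plus; simpl. specialize (H0 (S n)). lra.
  - intros n. rewrite rsum_sum_n. apply HB.
  - exists l. exact Hl.
Qed.

Lemma ex_CSeries_dom (a : nat -> C) (b : nat -> R) (B : R) :
  (forall n, Cmod (a n) <= b n) -> (forall n, rsum b n <= B) -> ex_CSeries a.
Proof.
  intros Hab HB.
  assert (E : ex_series b).
  { apply (ex_series_bounded b B); auto.
    intros n. eapply Rle_trans; [apply Cmod_ge_0|apply Hab]. }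
  split; (apply (ex_series_le (V := R_CompleteNormedModule) _ b); [|exact E]); intros n.
  - eapply Rle_trans; [apply re_le_Cmod|apply Hab].
  - eapply Rle_trans; [apply im_le_Cmod|apply Hab].
Qed.

Lemma CSeries_ext (a b : nat -> C) : (forall n, a n = b n) -> CSeries a = CSeries b.
Proof.
  intros H. unfold CSeries. f_equal; apply Series_ext; intros n; now rewrite H.
Qed.

Lemma CSeries_plus (a b : nat -> C) : ex_CSeries a -> ex_CSeries b ->
  CSeries (fun n => (a n + b n)%C) = (CSeries a + CSeries b)%C.
Proof.
  intros [A1 A2] [B1 B2]. unfold CSeries.
  unfold Cplus at 3; simpl. f_equal.
  - rewrite <- Series_plus by auto. now apply Series_ext.
  - rewrite <- Series_plus by auto. now apply Series_ext.
Qed.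

Lemma CSeries_lim (a : nat -> C) : ex_CSeries a ->
  forall eps, 0 < eps -> exists n0, forall n, (n0 <= n)%nat -> Cmod (CSeries a - csum a (S n)) <= eps.
Proof.
  intros [A1 A2] eps He.
  assert (H1 := Series_correct _ A1). assert (H2 := Series_correct _ A2).
  assert (He2 : 0 < eps / 2) by lra.
  assert (L1 := H1 _ (locally_ball _ (mkposreal _ He2))).
  assert (L2 := H2 _ (locally_ball _ (mkposreal _ He2))).
  destruct L1 as [n1 L1]. destruct L2 as [n2 L2].
  exists (max n1 n2). intros n Hn.
  assert (K1 := L1 n ltac:(lia)). assert (K2 := L2 n ltac:(lia)).
  change (Rabs (sum_n (fun n => Re (a n)) n - Series (fun n => Re (a n))) < eps / 2) in K1.
  change (Rabs (sum_n (fun n => Im (a n)) n - Series (fun n => Im (a n))) < eps / 2) in K2.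
  rewrite Rabs_minus_sym in K1. rewrite Rabs_minus_sym in K2.
  rewrite csum_sum_n.
  eapply Rle_trans; [apply Cmod_le_abs|]. simpl. unfold Rminus in *. lra.
Qed.

Lemma CSeries_approx (a : nat -> C) (z : C) (n0 : nat) (B : R) : ex_CSeries a ->
  (forall n, (n0 <= n)%nat -> Cmod (csum a n - z) <= B) -> Cmod (CSeries a - z) <= B.
Proof.
  intros Ha HB. apply le_epsilon. intros eps He.
  destruct (CSeries_lim a Ha eps He) as [n1 H1].
  specialize (H1 (max n0 n1) ltac:(lia)). specialize (HB (S (max n0 n1)) ltac:(lia)).
  replace (CSeries a - z)%C with
    ((csum a (S (max n0 n1)) - z) + (CSeries a - csum a (S (max n0 n1))))%C by ring.
  eapply Rle_trans; [apply Cmod_triangle|]. lra.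
Qed.

Lemma CSeries_first (a : nat -> C) : ex_CSeries (fun k => a (S k)) ->
  CSeries a = (a 0%nat + CSeries (fun k => a (S k)))%C.
Proof.
  intros [E1 E2].
  assert (F1 : ex_series (fun k => Re (a k))) by (now apply ex_series_incr_1).
  assert (F2 : ex_series (fun k => Im (a k))) by (now apply ex_series_incr_1).
  unfold CSeries. rewrite (Series_incr_1 _ F1), (Series_incr_1 _ F2).
  now destruct (a 0%nat).
Qed.

(** * Sums of powers, compared with integrals through the mean value theorem *)

Lemma Rpower_diff (n : nat) (t : R) : (1 <= n)%nat ->
  exists c, INR n < c < INR n + 1 /\ Rpower (INR n + 1) t - Rpower (INR n) t = t * Rpower c (t - 1).
Proof.
  intros Hn. assert (H1 : 1 <= INR n) by (apply (le_INR 1); auto).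
  destruct (MVT_cor2 (fun x => Rpower x t) (fun x => t * Rpower x (t - 1)) (INR n) (INR n + 1)) as [c [Ec Hc]].
  - lra.
  - intros c Hc. apply derivable_pt_lim_power. lra.
  - exists c. split; [exact Hc|]. rewrite Ec. ring.
Qed.

Lemma Rpower_pos (x y : R) : 0 < Rpower x y.
Proof. apply exp_pos. Qed.

Lemma Rpower_1_base (y : R) : Rpower 1 y = 1.
Proof. unfold Rpower. rewrite ln_1, Rmult_0_r. apply exp_0. Qed.

Lemma Rpower_antitone (x y t : R) : 0 < x <= y -> t <= 0 -> Rpower y t <= Rpower x t.
Proof.
  intros Hxy Ht. replace t with (- - t) by ring. rewrite !(Rpower_Ropp _ (- t)).
  apply Rinv_le_contravar; [apply Rpower_pos|]. apply Rle_Rpower_l; lra.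
Qed.

(** By the mean value theorem (n+1)^(-1-s) <= (n^(-s) - (n+1)^(-s)) / s, and the right-hand sides
    telescope; the induction keeps the negative end term. *)
Lemma Rpower_tail (n k : nat) (s : R) : (1 <= n)%nat -> 0 < s ->
  rsum (fun i => Rpower (INR (S n + i)) (- 1 - s)) k <= Rpower (INR n) (- s) / s.
Proof.
  intros Hn Hs.
  enough (H : rsum (fun i => Rpower (INR (S n + i)) (- 1 - s)) k
     <= (Rpower (INR n) (- s) - Rpower (INR (n + k)) (- s)) / s).
  { eapply Rle_trans; [exact H|]. apply Rmult_le_compat_r; [apply Rlt_le, Rinv_0_lt_compat; lra|].
    generalize (Rpower_pos (INR (n + k)) (- s)); lra. }
  induction k as [|k IH].
  - simpl. rewrite Nat.add_0_r. apply Req_le. field. lra.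
  - set (f := fun i => Rpower (INR (S n + i)) (- 1 - s)) in *.
    change (rsum f (S k)) with (rsum f k + Rpower (INR (S n + k)) (- 1 - s)).
    destruct (Rpower_diff (n + k) (- s) ltac:(lia)) as [c [Hc Ec]].
    assert (H1 : 1 <= INR (n + k)) by (apply (le_INR 1); lia).
    replace (n + S k)%nat with (S (n + k)) by lia.
    change (S n + k)%nat with (S (n + k)). rewrite !S_INR.
    assert (B : Rpower (INR (n + k) + 1) (- 1 - s) <= Rpower c (- s - 1)).
    { replace (- 1 - s) with (- s - 1) by ring. apply Rpower_antitone; lra. }
    replace ((Rpower (INR n) (- s) - Rpower (INR (n + k) + 1) (- s)) / s)
      with ((Rpower (INR n) (- s) - Rpower (INR (n + k)) (- s)) / s + Rpower c (- s - 1)).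
    + lra.
    + replace (Rpower (INR (n + k) + 1) (- s))
        with (Rpower (INR (n + k)) (- s) - s * Rpower c (- s - 1)) by lra.
      field. lra.
Qed.

(** For t <= 1 the summand decreases and telescoping gives n^t / t. For t > 1 it increases, the
    comparison covers all terms but the last, and t <= n bounds the last one by n^t / t as well;
    hence the factor 2. *)
Lemma Rpower_head (n : nat) (t : R) : (1 <= n)%nat -> 0 < t <= INR n ->
  rsum (fun i => Rpower (INR (S i)) (t - 1)) n <= 2 * Rpower (INR n) t / t.
Proof.
  intros Hn Ht.
  destruct (Rle_dec t 1) as [H1|H1].
  - enough (H : rsum (fun i => Rpower (INR (S i)) (t - 1)) n <= Rpower (INR n) t / t).
    { assert (0 < Rpower (INR n) t / t) by (apply Rdiv_lt_0_compat; [apply Rpower_pos|lra]).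
      unfold Rdiv in *. lra. }
    destruct Ht as [Ht _].
    destruct n as [|n]; [lia|]. clear Hn. induction n as [|n IH].
    + simpl. rewrite !Rpower_1_base. rewrite Rplus_0_l.
      apply Rmult_le_reg_r with t; [lra|]. field_simplify; lra.
    + change (rsum (fun i => Rpower (INR (S i)) (t - 1)) (S (S n)))
        with (rsum (fun i => Rpower (INR (S i)) (t - 1)) (S n) + Rpower (INR (S (S n))) (t - 1)).
      destruct (Rpower_diff (S n) t ltac:(lia)) as [c [Hc Ec]].
      assert (Hp : 1 <= INR (S n)) by (apply (le_INR 1); lia).
      rewrite (S_INR (S n)).
      assert (B : Rpower (INR (S n) + 1) (t - 1) <= Rpower c (t - 1)) by (apply Rpower_antitone; lra).
      replace (Rpower (INR (S n) + 1) t) with (Rpower (INR (S n)) t + t * Rpower c (t - 1)) by lra.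
      replace ((Rpower (INR (S n)) t + t * Rpower c (t - 1)) / t)
        with (Rpower (INR (S n)) t / t + Rpower c (t - 1)) by (field; lra).
      lra.
  - destruct n as [|n]; [lia|].
    change (rsum (fun i => Rpower (INR (S i)) (t - 1)) n + Rpower (INR (S n)) (t - 1)
      <= 2 * Rpower (INR (S n)) t / t).
    assert (Hp : 1 <= INR (S n)) by (apply (le_INR 1); lia).
    assert (A : rsum (fun i => Rpower (INR (S i)) (t - 1)) n <= Rpower (INR (S n)) t / t).
    { clear Hn Ht. induction n as [|n IH].
      - apply Rlt_le, Rdiv_lt_0_compat; [apply Rpower_pos|lra].
      - assert (Hp' : 1 <= INR (S n)) by (apply (le_INR 1); lia). specialize (IH Hp').
        set (f := fun i => Rpower (INR (S i)) (t - 1)) in *.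
        change (rsum f (S n)) with (rsum f n + Rpower (INR (S n)) (t - 1)).
        destruct (Rpower_diff (S n) t ltac:(lia)) as [c [Hc Ec]].
        rewrite (S_INR (S n)).
        assert (B : Rpower (INR (S n)) (t - 1) <= Rpower c (t - 1)) by (apply Rle_Rpower_l; lra).
        replace (Rpower (INR (S n) + 1) t) with (Rpower (INR (S n)) t + t * Rpower c (t - 1)) by lra.
        replace ((Rpower (INR (S n)) t + t * Rpower c (t - 1)) / t)
          with (Rpower (INR (S n)) t / t + Rpower c (t - 1)) by (field; lra).
        lra. }
    assert (B : Rpower (INR (S n)) (t - 1) <= Rpower (INR (S n)) t / t).
    { assert (E : Rpower (INR (S n)) t = Rpower (INR (S n)) (t - 1) * INR (S n)).
      { rewrite <- (Rpower_1 (INR (S n))) at 3 by lra. rewrite <- Rpower_plus. f_equal. ring. }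
      rewrite E. assert (P := Rpower_pos (INR (S n)) (t - 1)).
      apply Rmult_le_reg_r with t; [lra|]. field_simplify; [|lra]. nra. }
    unfold Rdiv in *. lra.
Qed.

(** * The Dirichlet series of log L *)

Lemma rsum_shift (f : nat -> R) (n k : nat) :
  rsum f (n + k) = rsum f n + rsum (fun i => f (n + i)%nat) k.
Proof.
  induction k as [|k IH]; [rewrite Nat.add_0_r; simpl; ring|].
  rewrite Nat.add_succ_r. simpl. rewrite IH. ring.
Qed.

Lemma rsum_nonneg (f : nat -> R) (n : nat) : (forall k, 0 <= f k) -> 0 <= rsum f n.
Proof. intros H. induction n as [|n IH]; simpl; [lra|]. specialize (H n). lra. Qed.

(** [csum a (S X)] runs over the indices up to and including X, so the tail begins at X + 1, as in
    [Rpower_tail]. *)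
Lemma csum_power_tail (a : nat -> C) (K s : R) (X n : nat) : (1 <= X)%nat -> 0 < s -> 0 <= K ->
  (forall n, (1 <= n)%nat -> Cmod (a n) <= K * Rpower (INR n) (- 1 - s)) ->
  (S X <= n)%nat -> Cmod (csum a n - csum a (S X)) <= K * (Rpower (INR X) (- s) / s).
Proof.
  intros HX Hs HK Ha Hn.
  replace n with (S X + (n - S X))%nat by lia. rewrite csum_shift.
  replace (csum a (S X) + csum (fun i => a (S X + i)%nat) (n - S X) - csum a (S X))%C
    with (csum (fun i => a (S X + i)%nat) (n - S X)) by ring.
  eapply Rle_trans.
  { apply (Cmod_csum_le _ (fun i => K * Rpower (INR (S X + i)) (- 1 - s))).
    intros k _. apply Ha. lia. }
  rewrite rsum_scal. apply Rmult_le_compat_l; [exact HK|]. now apply Rpower_tail.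
Qed.

Lemma ex_CSeries_power (a : nat -> C) (K s : R) : 0 < s -> 0 <= K ->
  (forall n, (1 <= n)%nat -> Cmod (a n) <= K * Rpower (INR n) (- 1 - s)) -> ex_CSeries a.
Proof.
  intros Hs HK Ha.
  apply (ex_CSeries_dom a (fun n => Cmod (a n)) (Cmod (a 0%nat) + Cmod (a 1%nat) + K * (Rpower (INR 1) (- s) / s))).
  - intros; lra.
  (* The indices 0 and 1 are split off: the bound says nothing about index 0, and the tail estimate
     after 1 starts at 2. *)
  - intros n. apply Rle_trans with (rsum (fun n => Cmod (a n)) (2 + n)).
    + rewrite Nat.add_comm, rsum_shift.
      assert (H := rsum_nonneg (fun i => Cmod (a (n + i)%nat)) 2 (fun _ => Cmod_ge_0 _)). lra.
    + rewrite rsum_shift. simpl (rsum _ 2). rewrite Rplus_0_l. apply Rplus_le_compat_l.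
      eapply Rle_trans.
      { apply (rsum_le _ (fun i => K * Rpower (INR (2 + i)) (- 1 - s))). intros k _. apply Ha. lia. }
      rewrite rsum_scal. apply Rmult_le_compat_l; [exact HK|]. now apply (Rpower_tail 1).
Qed.

Lemma CSeries_power_tail (a : nat -> C) (K s : R) (X : nat) : (1 <= X)%nat -> 0 < s -> 0 <= K ->
  (forall n, (1 <= n)%nat -> Cmod (a n) <= K * Rpower (INR n) (- 1 - s)) ->
  Cmod (CSeries a - csum a (S X)) <= K * (Rpower (INR X) (- s) / s).
Proof.
  intros HX Hs HK Ha. apply (CSeries_approx a _ (S X)).
  - now apply (ex_CSeries_power a K s).
  - intros n Hn. now apply csum_power_tail.
Qed.

Lemma primeb_prime (n : nat) : primeb n = true -> prime (Z.of_nat n) /\ (2 <= n)%nat.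
Proof.
  unfold primeb. destruct (prime_dec (Z.of_nat n)) as [H|H]; [|discriminate].
  intros _. split; auto. apply prime_ge_2 in H. lia.
Qed.

(** Since 0 and 1 are not prime, the whole sum is a tail beyond X = 1, which costs the factor 1 /
    (1/12) = 12. *)
Lemma prime_csum_bound (a : nat -> C) (K : R) (n : nat) : 0 <= K -> (2 <= n)%nat ->
  (forall n, primeb n = false -> a n = 0%C) ->
  (forall n, primeb n = true -> Cmod (a n) <= K * Rpower (INR n) (- 1 - 1 / 12)) ->
  Cmod (csum a n) <= 12 * K.
Proof.
  intros HK Hn H0 Ha.
  assert (P0 : a 0%nat = 0%C).
  { apply H0, not_true_is_false. intros E. apply primeb_prime in E. lia. }
  assert (P1 : a 1%nat = 0%C).
  { apply H0, not_true_is_false. intros E. apply primeb_prime in E. lia. }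
  replace (csum a n) with (csum a n - csum a 2)%C by (simpl; rewrite P0, P1; ring).
  replace (12 * K) with (K * (Rpower (INR 1) (- (1 / 12)) / (1 / 12))).
  - apply csum_power_tail; auto; try lra. intros k Hk.
    destruct (primeb k) eqn:E; [now apply Ha|]. rewrite (H0 k E), Cmod_0.
    apply Rmult_le_pos; [lra|apply Rlt_le, Rpower_pos].
  - simpl. rewrite Rpower_1_base. field.
Qed.

Lemma Cmod_npow (n : nat) (s : C) : Cmod (npow n s) = Rpower (INR n) (Re s).
Proof.
  unfold npow. rewrite Cmod_Cexp. unfold Rpower. f_equal. simpl. unfold Re. ring.
Qed.

(** This bounds the ratio p^(-Re s) of the geometric series in l at the smallest prime, for Re s >=
    13/24. *)
Lemma Rpower_2_bound : Rpower 2 (- (13 / 24)) <= 3 / 4.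
Proof.
  assert (S0 := sqrt_sqrt 2 ltac:(lra)). assert (S1 : 0 < sqrt 2) by (apply sqrt_lt_R0; lra).
  apply Rle_trans with (Rpower 2 (- / 2)).
  - apply Rle_Rpower; lra.
  - rewrite Rpower_Ropp, Rpower_sqrt by lra.
    apply Rmult_le_reg_r with (sqrt 2); [lra|]. rewrite Rinv_l by lra. nra.
Qed.

Lemma geom_sum (n : nat) : rsum (fun k => (3 / 4) ^ k) n = 4 * (1 - (3 / 4) ^ n).
Proof. induction n as [|n IH]; simpl; [ring|]. rewrite IH. field. Qed.

Section LogTerms.

Variables (m : nat) (c : nat -> nat -> C).
Hypothesis Hc : forall p j : nat, prime (Z.of_nat p) -> (1 <= j <= m)%nat -> Cmod (c p j) <= 1.

Lemma d_coef_bound (p l : nat) : primeb p = true -> Cmod (d_coef m c p l) <= INR m.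
Proof.
  intros Hp. apply primeb_prime in Hp. destruct Hp as [Hp _].
  assert (G : forall s k, (1 <= s)%nat -> (s + k <= S m)%nat ->
    Cmod (Iter.iter Cplus (RtoC 0) (seq s k) (fun j => Cpow (c p j) l)) <= INR k).
  { intros s k. revert s. induction k as [|k IH]; intros s Hs Hk.
    - simpl. rewrite Cmod_0. lra.
    - change (Iter.iter Cplus (RtoC 0) (seq s (S k)) (fun j => Cpow (c p j) l))
        with (Cpow (c p s) l + Iter.iter Cplus (RtoC 0) (seq (S s) k) (fun j => Cpow (c p j) l))%C.
      eapply Rle_trans; [apply Cmod_triangle|]. rewrite S_INR.
      specialize (IH (S s) ltac:(lia) ltac:(lia)).
      assert (B : Cmod (Cpow (c p s) l) <= 1).
      { rewrite Cmod_pow. rewrite <- (pow1 l). apply pow_incr.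
        split; [apply Cmod_ge_0|]. apply Hc; auto. lia. }
      lra. }
  apply G; lia.
Qed.

Lemma log_term_bound (s : C) (p l : nat) : primeb p = true -> (1 <= l)%nat ->
  Cmod (log_term m c s p l) <= INR m * Rpower (INR p) (- (INR l * Re s)).
Proof.
  intros Hp Hl. unfold log_term.
  assert (L1 : 1 <= INR l) by (apply (le_INR 1); auto).
  assert (Q := Rpower_pos (INR p) (INR l * Re s)).
  assert (E : Cmod (INR l * npow p (INR l * s))%C = INR l * Rpower (INR p) (INR l * Re s)).
  { rewrite Cmod_mult, Cmod_R, Rabs_right, Cmod_npow by lra. f_equal. f_equal.
    simpl. unfold Re. ring. }
  assert (D : 0 < INR l * Rpower (INR p) (INR l * Re s)) by nra.
  rewrite Cmod_div by (apply Cmod_gt_0; lra). rewrite E.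
  apply Rmult_le_compat.
  - apply Cmod_ge_0.
  - apply Rlt_le, Rinv_0_lt_compat, D.
  - now apply d_coef_bound.
  - rewrite Rpower_Ropp. apply Rinv_le_contravar; nra.
Qed.

(** Two of the k + 2 factors p^(-Re s) give p^(-13/12), summable over primes; the other k are at
    most 3/4 each. *)
Lemma log_term_bound_ge2 (s : C) (p k : nat) : primeb p = true -> 13 / 24 <= Re s ->
  Cmod (log_term m c s p (k + 2)) <= INR m * Rpower (INR p) (- 1 - 1 / 12) * (3 / 4) ^ k.
Proof.
  intros Hp Hs. eapply Rle_trans; [apply log_term_bound; auto; lia|].
  apply primeb_prime in Hp. destruct Hp as [_ Hp]. assert (P2 : 2 <= INR p) by (apply (le_INR 2); auto).
  rewrite Rmult_assoc. apply Rmult_le_compat_l; [apply pos_INR|].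
  rewrite plus_INR. change (INR 2) with 2. assert (K0 := pos_INR k).
  apply Rle_trans with (Rpower (INR p) (- 1 - 1 / 12 + - (13 / 24) * INR k)).
  - apply Rle_Rpower; [lra|]. nra.
  - rewrite Rpower_plus. apply Rmult_le_compat_l; [apply Rlt_le, Rpower_pos|].
    rewrite <- Rpower_mult, Rpower_pow by apply Rpower_pos.
    apply pow_incr. split; [apply Rlt_le, Rpower_pos|].
    apply Rle_trans with (Rpower 2 (- (13 / 24))); [|apply Rpower_2_bound].
    apply Rpower_antitone; lra.
Qed.

Lemma ex_higher (s : C) (p : nat) : primeb p = true -> 13 / 24 <= Re s ->
  ex_CSeries (fun k => log_term m c s p (k + 2)).
Proof.
  intros Hp Hs.
  assert (P := Rpower_pos (INR p) (- 1 - 1 / 12)). assert (M := pos_INR m).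
  apply (ex_CSeries_dom _ (fun k => INR m * Rpower (INR p) (- 1 - 1 / 12) * (3 / 4) ^ k)
    (INR m * Rpower (INR p) (- 1 - 1 / 12) * 4)).
  - intros k. now apply log_term_bound_ge2.
  - intros n. rewrite rsum_scal, geom_sum. apply Rmult_le_compat_l; [nra|].
    assert (0 < (3 / 4) ^ n) by (apply pow_lt; lra). lra.
Qed.

Lemma higher_partial_bound (s : C) (p n k : nat) : primeb p = true -> 13 / 24 <= Re s ->
  Cmod (csum (fun k => log_term m c s p (k + 2)) (n + k) - csum (fun k => log_term m c s p (k + 2)) n)
  <= 4 * INR m * (3 / 4) ^ n * Rpower (INR p) (- 1 - 1 / 12).
Proof.
  intros Hp Hs. rewrite csum_shift.
  set (a := csum (fun k => log_term m c s p (k + 2)) n).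
  replace (a + csum (fun i => log_term m c s p (n + i + 2)) k - a)%C
    with (csum (fun i => log_term m c s p (n + i + 2)) k) by ring.
  assert (P := Rpower_pos (INR p) (- 1 - 1 / 12)). assert (M := pos_INR m).
  assert (N : 0 < (3 / 4) ^ n) by (apply pow_lt; lra).
  eapply Rle_trans.
  { apply (Cmod_csum_le _ (fun i => (INR m * Rpower (INR p) (- 1 - 1 / 12) * (3 / 4) ^ n) * (3 / 4) ^ i)).
    intros i _. eapply Rle_trans; [apply log_term_bound_ge2; auto|].
    rewrite pow_add. apply Req_le. ring. }
  rewrite rsum_scal, geom_sum.
  assert (0 < (3 / 4) ^ k) by (apply pow_lt; lra).
  assert (Q : 0 <= INR m * Rpower (INR p) (- 1 - 1 / 12) * (3 / 4) ^ n) by (repeat apply Rmult_le_pos; lra).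
  apply Rle_trans with (INR m * Rpower (INR p) (- 1 - 1 / 12) * (3 / 4) ^ n * 4); [|apply Req_le; ring].
  apply Rmult_le_compat_l; lra.
Qed.

Lemma higher_approx (s : C) (p n : nat) : primeb p = true -> 13 / 24 <= Re s ->
  Cmod (CSeries (fun k => log_term m c s p (k + 2)) - csum (fun k => log_term m c s p (k + 2)) n)
  <= 4 * INR m * (3 / 4) ^ n * Rpower (INR p) (- 1 - 1 / 12).
Proof.
  intros Hp Hs. apply (CSeries_approx _ _ n); [now apply ex_higher|].
  intros k Hk. replace k with (n + (k - n))%nat by lia. now apply higher_partial_bound.
Qed.

Definition higher_series (s : C) : C :=
  prime_series (fun p => CSeries (fun k => log_term m c s p (k + 2))).

(* A finite sum is holomorphic for free; Y tends to infinity, with everything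
   else fixed, only after the contour estimate. *)
Definition higher_trunc (Y : nat) (s : C) : C :=
  csum (fun p => if primeb p then csum (fun k => log_term m c s p (k + 2)) Y else RtoC 0) (S Y).

(** The sum S of the contour argument, in the variable s = 1 + w. *)
Definition linear_trunc (X : nat) (s : C) : C :=
  csum (fun p => if primeb p then log_term m c s p 1 else RtoC 0) (S X).

(** The first term accounts for the primes p > Y, the second for the exponents l >= Y + 2 at primes
    p <= Y. *)
Definition trunc_err (Y : nat) : R := 48 * INR m * (Rpower (INR Y) (- (1 / 12)) + (3 / 4) ^ Y).

Lemma higher_term_bound (s : C) (p : nat) : primeb p = true -> 13 / 24 <= Re s ->
  Cmod (CSeries (fun k => log_term m c s p (k + 2))) <= 4 * INR m * Rpower (INR p) (- 1 - 1 / 12).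
Proof.
  intros Hp Hs. assert (H := higher_approx s p 0 Hp Hs). simpl in H.
  replace (CSeries (fun k => log_term m c s p (k + 2)) - 0)%C
    with (CSeries (fun k => log_term m c s p (k + 2))) in H by ring. lra.
Qed.

Lemma higher_outer_bound (s : C) (n : nat) : 13 / 24 <= Re s ->
  Cmod (if primeb n then CSeries (fun k => log_term m c s n (k + 2)) else RtoC 0)
  <= 4 * INR m * Rpower (INR n) (- 1 - 1 / 12).
Proof.
  intros Hs. destruct (primeb n) eqn:E; [now apply higher_term_bound|].
  rewrite Cmod_0. assert (P := Rpower_pos (INR n) (- 1 - 1 / 12)). assert (M := pos_INR m). nra.
Qed.

Lemma higher_series_approx (s : C) (Y : nat) : (1 <= Y)%nat -> 13 / 24 <= Re s ->
  Cmod (higher_series s - higher_trunc Y s) <= trunc_err Y.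
Proof.
  intros HY Hs. assert (M := pos_INR m).
  set (a := fun n => if primeb n then CSeries (fun k => log_term m c s n (k + 2)) else RtoC 0).
  change (higher_series s) with (CSeries a).
  replace (CSeries a - higher_trunc Y s)%C
    with ((CSeries a - csum a (S Y)) + (csum a (S Y) - higher_trunc Y s))%C by ring.
  eapply Rle_trans; [apply Cmod_triangle|]. unfold trunc_err. rewrite Rmult_plus_distr_l.
  apply Rplus_le_compat.
  - replace (48 * INR m * Rpower (INR Y) (- (1 / 12)))
      with (4 * INR m * (Rpower (INR Y) (- (1 / 12)) / (1 / 12))) by field.
    apply CSeries_power_tail; auto; try lra.
    intros n _. now apply higher_outer_bound.
  - unfold higher_trunc. rewrite <- csum_minus.
    replace (48 * INR m * (3 / 4) ^ Y) with (12 * (4 * INR m * (3 / 4) ^ Y)) by ring.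
    apply prime_csum_bound; try lia.
    + assert (0 < (3 / 4) ^ Y) by (apply pow_lt; lra). repeat apply Rmult_le_pos; lra.
    + intros n E. unfold a. rewrite E. ring.
    + intros n E. unfold a. rewrite E. now apply higher_approx.
Qed.

(** Uniformity in Y keeps the bound for g in the left half-plane independent of the truncation. *)
Lemma higher_trunc_bound (s : C) (Y : nat) : (1 <= Y)%nat -> 13 / 24 <= Re s ->
  Cmod (higher_trunc Y s) <= 48 * INR m.
Proof.
  intros HY Hs. assert (M := pos_INR m).
  replace (48 * INR m) with (12 * (4 * INR m)) by ring.
  apply prime_csum_bound; try lia; try lra.
  - intros n E. now rewrite E.
  - intros n E. rewrite E. assert (H := higher_partial_bound s n 0 Y E Hs).
    simpl in H. replace (csum (fun k => log_term m c s n (k + 2)) Y - 0)%C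
      with (csum (fun k => log_term m c s n (k + 2)) Y) in H by ring. lra.
Qed.

Lemma Cderiv_log_term (s : C) (p l : nat) : (1 <= l)%nat ->
  exists k, Cderiv (fun s => log_term m c s p l) s k.
Proof.
  intros Hl. eexists. unfold log_term.
  apply (Cderiv_mult (fun _ => d_coef m c p l) (fun s => / (INR l * npow p (INR l * s)))%C);
    [apply Cderiv_const|].
  apply (Cderiv_inv (fun s => INR l * npow p (INR l * s))%C).
  - apply (Cderiv_mult (fun _ => RtoC (INR l)) (fun s => npow p (INR l * s))); [apply Cderiv_const|].
    unfold npow.
    apply (Cderiv_comp (fun s => INR l * s * ln (INR p))%C Cexp); [|apply Cderiv_Cexp].
    apply (Cderiv_mult (fun s => INR l * s)%C (fun _ => RtoC (ln (INR p)))); [|apply Cderiv_const].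
    apply (Cderiv_mult (fun _ => RtoC (INR l)) (fun s => s)); [apply Cderiv_const|apply Cderiv_id].
  - assert (L1 : 1 <= INR l) by (apply (le_INR 1); auto).
    apply Cmod_gt_0. rewrite Cmod_mult, Cmod_R, Cmod_npow, Rabs_right by lra.
    apply Rmult_lt_0_compat; [lra|apply Rpower_pos].
Qed.

Lemma Cderiv_higher_trunc (Y : nat) (s : C) : exists k, Cderiv (higher_trunc Y) s k.
Proof.
  unfold higher_trunc.
  apply (Cderiv_csum (fun p s => if primeb p then csum (fun k => log_term m c s p (k + 2)) Y else RtoC 0)).
  intros p. destruct (primeb p).
  - apply (Cderiv_csum (fun k s => log_term m c s p (k + 2))). intros k. apply Cderiv_log_term. lia.
  - exists 0%C. apply Cderiv_const.
Qed.

Lemma Cderiv_linear_trunc (X : nat) (s : C) : exists k, Cderiv (linear_trunc X) s k.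
Proof.
  unfold linear_trunc.
  apply (Cderiv_csum (fun p s => if primeb p then log_term m c s p 1 else RtoC 0)).
  intros p. destruct (primeb p).
  - apply Cderiv_log_term. lia.
  - exists 0%C. apply Cderiv_const.
Qed.

Lemma linear_term_bound (s : C) (n : nat) :
  Cmod (if primeb n then log_term m c s n 1 else RtoC 0) <= INR m * Rpower (INR n) (- Re s).
Proof.
  destruct (primeb n) eqn:E.
  - assert (H := log_term_bound s n 1 E ltac:(lia)). simpl (INR 1) in H. now rewrite Rmult_1_l in H.
  - rewrite Cmod_0. apply Rmult_le_pos; [apply pos_INR|apply Rlt_le, Rpower_pos].
Qed.

(** This controls g - S for Re w = Re s - 1 > 0: the linear terms beyond X, majorised by a sum over
    all integers n > X, and the truncation error of the terms with l >= 2. *)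
Lemma log_series_approx (s : C) (X Y : nat) : (1 <= X)%nat -> (1 <= Y)%nat -> 1 < Re s ->
  Cmod (log_series m c s - higher_trunc Y s - linear_trunc X s)
  <= INR m * (Rpower (INR X) (- (Re s - 1)) / (Re s - 1)) + trunc_err Y.
Proof.
  intros HX HY Hs. assert (M := pos_INR m).
  set (A := fun n => if primeb n then log_term m c s n 1 else RtoC 0).
  set (B := fun n => if primeb n then CSeries (fun k => log_term m c s n (k + 2)) else RtoC 0).
  assert (BA : forall n, (1 <= n)%nat -> Cmod (A n) <= INR m * Rpower (INR n) (- 1 - (Re s - 1))).
  { intros n _. replace (- 1 - (Re s - 1)) with (- Re s) by ring. apply linear_term_bound. }
  assert (EA : ex_CSeries A) by (apply (ex_CSeries_power A (INR m) (Re s - 1)); auto; lra).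
  assert (EB : ex_CSeries B).
  { apply (ex_CSeries_power B (4 * INR m) (1 / 12)); try lra.
    intros n _. apply higher_outer_bound. lra. }
  assert (E : log_series m c s = (CSeries A + CSeries B)%C).
  { rewrite <- CSeries_plus by auto. apply CSeries_ext. intros n. unfold A, B.
    destruct (primeb n) eqn:P; [|ring].
    rewrite (CSeries_first (fun k => log_term m c s n (k + 1))).
    - f_equal. apply CSeries_ext. intros k. f_equal. lia.
    - assert (H := ex_higher s n P ltac:(lra)).
      destruct H as [H1 H2]. split; [eapply ex_series_ext; [|exact H1]|eapply ex_series_ext; [|exact H2]];
        intros k; simpl; replace (k + 2)%nat with (S (k + 1)) by lia; reflexivity. }
  rewrite E. change (CSeries B) with (higher_series s).
  replace (CSeries A + higher_series s - higher_trunc Y s - linear_trunc X s)%C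
    with ((CSeries A - csum A (S X)) + (higher_series s - higher_trunc Y s))%C
    by (unfold linear_trunc; fold A; ring).
  eapply Rle_trans; [apply Cmod_triangle|]. apply Rplus_le_compat.
  - apply CSeries_power_tail; auto; lra.
  - apply higher_series_approx; auto; lra.
Qed.

(** This controls S for Re w < 0, where its growth X^(-Re w) is undone by the kernel. *)
Lemma linear_trunc_bound (s : C) (X : nat) : (1 <= X)%nat -> 0 < 1 - Re s <= INR X ->
  Cmod (linear_trunc X s) <= 2 * INR m * Rpower (INR X) (1 - Re s) / (1 - Re s).
Proof.
  intros HX Hs. unfold linear_trunc. rewrite csum_S_first.
  assert (P0 : primeb 0 = false).
  { apply not_true_is_false. intros E. apply primeb_prime in E. lia. }
  rewrite P0, Cplus_0_l.
  eapply Rle_trans.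
  { apply (Cmod_csum_le _ (fun i => INR m * Rpower (INR (S i)) ((1 - Re s) - 1))).
    intros k _. replace (1 - Re s - 1) with (- Re s) by ring. apply linear_term_bound. }
  rewrite rsum_scal.
  replace (2 * INR m * Rpower (INR X) (1 - Re s) / (1 - Re s))
    with (INR m * (2 * Rpower (INR X) (1 - Re s) / (1 - Re s))) by (field; lra).
  apply Rmult_le_compat_l; [apply pos_INR|]. now apply Rpower_head.
Qed.

End LogTerms.

(** * Conclusion *)

Lemma Rpower_inv_12 (e : R) (Y : nat) : 0 < e -> Rpower e (- 12) <= INR Y ->
  Rpower (INR Y) (- (1 / 12)) <= e.
Proof.
  intros He HY. apply Rle_trans with (Rpower (Rpower e (- 12)) (- (1 / 12))).
  - apply Rpower_antitone; [|lra]. split; [apply Rpower_pos|exact HY].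
  - rewrite Rpower_mult. replace (- 12 * - (1 / 12)) with 1 by field. rewrite Rpower_1; lra.
Qed.

Lemma trunc_err_small (m : nat) (eps : R) : 0 < eps ->
  exists Y, (1 <= Y)%nat /\ 0 <= trunc_err m Y <= eps.
Proof.
  intros He. assert (M := pos_INR m).
  (* Both parts of [trunc_err] will be at most e, and 48 * 2 = 96; m + 1 keeps the denominator
     positive. *)
  set (e := eps / (96 * (INR m + 1))).
  assert (e0 : 0 < e) by (apply Rdiv_lt_0_compat; lra).
  destruct (pow_lt_1_zero (3 / 4) ltac:(rewrite Rabs_right; lra) e e0) as [n1 H1].
  destruct (INR_unbounded (Rpower e (- 12))) as [n2 H2].
  exists (S (n1 + n2)). split; [lia|].
  set (Y := S (n1 + n2)).
  assert (A : Rpower (INR Y) (- (1 / 12)) <= e).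
  { apply Rpower_inv_12; auto. apply Rlt_le. eapply Rlt_le_trans; [exact H2|].
    apply le_INR. unfold Y. lia. }
  specialize (H1 Y ltac:(unfold Y; lia)).
  assert (P : 0 < (3 / 4) ^ Y) by (apply pow_lt; lra).
  assert (Q := Rpower_pos (INR Y) (- (1 / 12))).
  rewrite Rabs_right in H1 by lra. unfold trunc_err. split.
  - apply Rmult_le_pos; lra.
  - apply Rle_trans with (48 * INR m * (e + e)); [apply Rmult_le_compat_l; lra|].
    apply Rle_trans with (48 * (INR m + 1) * (e + e)); [apply Rmult_le_compat_r; lra|].
    unfold e. apply Req_le. field. lra.
Qed.

Lemma Cplus_1_pair (x y : R) : (1 + (x, y))%C = (1 + x, y).
Proof. unfold Cplus, RtoC; simpl. f_equal; ring. Qed.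

Lemma Cderiv_shift1 (f : C -> C) (w : C) :
  (exists l, Cderiv f (1 + w)%C l) -> exists l, Cderiv (fun w => f (1 + w)%C) w l.
Proof.
  intros [l Hl]. eexists.
  apply (Cderiv_comp (fun w => 1 + w)%C f); [|exact Hl].
  apply (Cderiv_plus (fun _ => RtoC 1) (fun w => w)); [apply Cderiv_const|apply Cderiv_id].
Qed.

(** With l = log N it makes (1 + |t|)^gamma2 at most N^(5 gamma2) up to the height of the zero-free
    region. Writing v = exp l >= 2, one has 1 + 2 l^3 <= 3 v^3 <= v^5. *)
Lemma ln_1_cube (l t : R) : 1 <= l -> 0 <= t <= 2 * l ^ 3 -> ln (1 + t) <= 5 * l.
Proof.
  intros Hl Ht. rewrite <- (ln_exp (5 * l)).
  apply ln_le; [lra|].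
  assert (E : l <= exp l) by (generalize (exp_ineq1_le l); lra).
  assert (E5 : exp (5 * l) = exp l ^ 5).
  { replace (5 * l) with (l + (l + (l + (l + l)))) by ring. rewrite !exp_plus. ring. }
  rewrite E5. set (v := exp l) in *.
  assert (E2 : 2 <= v) by (generalize (exp_ineq1_le l); fold v; lra).
  assert (l ^ 3 <= v ^ 3) by (apply pow_incr; lra).
  assert (V3 : 1 <= v ^ 3) by (apply pow_R1_Rle; lra).
  replace (v ^ 5) with (v ^ 3 * (v * v)) by ring.
  assert (4 <= v * v) by nra. nra.
Qed.

Section Assembly.

Variables (m : nat) (delta gamma1 gamma2 K : R).
Hypothesis Hdelta : 0 < delta < 7 / 2.
Hypotheses (Hg1 : 0 < gamma1) (Hg2 : 0 < gamma2) (HK : 0 < K).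
Variables (N : nat) (c : nat -> nat -> C) (L logL : C -> C) (sigmaL : R).
Hypothesis HN : (16 <= N)%nat.
Hypothesis Hc : forall p j : nat, prime (Z.of_nat p) -> (1 <= j <= m)%nat -> Cmod (c p j) <= 1.
Hypothesis Hsig : delta < 7 * (1 - sigmaL).
Hypothesis HL : forall s : C, sigmaL < Re s < 4 ->
  Cmod (L s) <= K * Rpower (INR N) gamma1 * Rpower (1 + Rabs (Im s)) gamma2.
Hypothesis Hlog : is_log_branch m c L (D_region delta N) logL.

Let l := ln (INR N).

Lemma ln_N_ge_2 : 2 <= l.
Proof.
  unfold l. rewrite <- (ln_exp 2). apply ln_le; [apply exp_pos|].
  (* From exp 1 <= 3 follows exp 2 <= 9 < 16 <= N. *)
  assert (E : exp 2 = exp 1 * exp 1) by (rewrite <- exp_plus; f_equal; ring).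
  assert (P := exp_pos 1). assert (Q := exp_le_3).
  assert (J : INR 16 <= INR N) by (apply le_INR; auto). simpl in J. rewrite E. nra.
Qed.

(** The strict inequalities make (x, y) an interior point of D, so that the relative derivative of
    [logL] becomes a true one. *)
Lemma Cderiv_logL (x y : R) : 1 - delta / 7 < x -> Rabs y < 2 * l ^ 3 ->
  exists k, Cderiv logL (x, y) k.
Proof.
  intros Hx Hy. destruct Hlog as [Hh _].
  apply (holomorphic_on_Cderiv _ _ _ Hh). apply locally_Cmod.
  exists (Rmin (x - (1 - delta / 7)) (2 * l ^ 3 - Rabs y)). split; [apply Rmin_glb_lt; lra|].
  intros w Hw.
  assert (M1 := Rmin_l (x - (1 - delta / 7)) (2 * l ^ 3 - Rabs y)).
  assert (M2 := Rmin_r (x - (1 - delta / 7)) (2 * l ^ 3 - Rabs y)).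
  assert (A := re_le_Cmod (w - (x, y))%C). assert (B := im_le_Cmod (w - (x, y))%C).
  replace (Re (w - (x, y))) with (Re w - x) in A by (unfold Re; simpl; ring).
  replace (Im (w - (x, y))) with (Im w - y) in B by (unfold Im; simpl; ring).
  apply Rabs_le_between in A.
  assert (T := Rabs_triang (Im w - y) y). replace (Im w - y + y) with (Im w) in T by ring.
  unfold D_region. fold l. destruct (Rle_dec 1 (Re w)) as [|n]; [now left|right]. lra.
Qed.

(** The logarithm of hypothesis (iii) divided by l, with 5 taken from [ln_1_cube]; the final 1 makes
    the inequality strict, as [borel_caratheodory_segment] asks. *)
Let C1 := Rabs (ln K) + gamma1 + 5 * gamma2 + 1.

Lemma Re_logL_lt (x y : R) : 1 - delta / 7 <= x < 4 -> Rabs y <= 2 * l ^ 3 ->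
  Re (logL (x, y)) < C1 * l.
Proof.
  intros Hx Hy. destruct Hlog as [_ [He _]]. assert (Hl := ln_N_ge_2).
  assert (HD : D_region delta N (x, y)).
  { unfold D_region; simpl. fold l. destruct (Rle_dec 1 x) as [|n]; [now left|right; lra]. }
  assert (B := HL (x, y) ltac:(simpl; lra)).
  rewrite <- (He _ HD), Cmod_Cexp in B. simpl in B.
  assert (P1 := Rpower_pos (INR N) gamma1). assert (P2 := Rpower_pos (1 + Rabs y) gamma2).
  assert (P3 : 0 < K * Rpower (INR N) gamma1) by now apply Rmult_lt_0_compat.
  apply ln_le in B; [|apply exp_pos].
  rewrite ln_exp, !ln_mult in B by auto. unfold Rpower in B. rewrite !ln_exp in B. fold l in B.
  assert (Q := ln_1_cube l (Rabs y) ltac:(lra) (conj (Rabs_pos y) Hy)).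
  assert (Q2 := Rle_abs (ln K)). assert (Q3 := Rabs_pos (ln K)).
  unfold C1. nra.
Qed.

(** The three terms come from [log_series_approx] with X = Y = 1 at Re s = 2, where the linear part
    is empty, and from [higher_trunc_bound]. *)
Let M0 := INR m + trunc_err m 1 + 48 * INR m.

Lemma Cmod_logL_2 (y : R) : Cmod (logL (2, y)) <= M0.
Proof.
  destruct Hlog as [_ [_ Hs]].
  rewrite Hs by (simpl; lra).
  assert (A := log_series_approx m c Hc (2, y) 1 1 ltac:(lia) ltac:(lia) ltac:(simpl; lra)).
  assert (B := higher_trunc_bound m c Hc (2, y) 1 ltac:(lia) ltac:(simpl; lra)).
  assert (E : linear_trunc m c 1 (2, y) = 0%C).
  { assert (P0 : primeb 0 = false).
    { apply not_true_is_false. intros E. apply primeb_prime in E. lia. }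
    assert (P1 : primeb 1 = false).
    { apply not_true_is_false. intros E. apply primeb_prime in E. lia. }
    unfold linear_trunc. cbn [csum]. rewrite P0, P1. ring. }
  rewrite E in A. simpl (Re (2, y)) in A. simpl (INR 1) in A. rewrite Rpower_1_base in A.
  replace (INR m * (1 / (2 - 1))) with (INR m) in A by field.
  replace (log_series m c (2, y)) with
    ((log_series m c (2, y) - higher_trunc m c 1 (2, y) - 0) + higher_trunc m c 1 (2, y))%C by ring.
  eapply Rle_trans; [apply Cmod_triangle|]. unfold M0. lra.
Qed.

(** The abscissa 1 - b stays delta/84 inside the zero-free region; h is half of this gap. *)
Let h := delta / 168.
Let b := 11 * delta / 84.
(** The factors of [borel_caratheodory_segment] for a segment of length at most 2. *)
Let C2 := 48 / h * exp (24 / h).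
Let C3 := M0 + C2 * (C1 + M0) + 48 * INR m.

Lemma M0_nonneg : 0 <= M0.
Proof. eapply Rle_trans; [apply Cmod_ge_0|apply (Cmod_logL_2 0)]. Qed.

Lemma C2_pos : 0 < C2.
Proof.
  unfold C2. apply Rmult_lt_0_compat; [|apply exp_pos]. apply Rdiv_lt_0_compat; unfold h; lra.
Qed.

Lemma C1_pos : 0 < C1.
Proof. unfold C1. generalize (Rabs_pos (ln K)). lra. Qed.

(** The bound is carried along a horizontal segment from Re s = 2, where log L is bounded. The
    h-neighbourhood of the segment remains in the region because b + h < delta/7 and l + h < 2 l^3,
    and left of Re s = 4 because h < 1. *)
Lemma Cmod_logL_left (x y : R) : 1 - b <= x < 1 -> Rabs y <= l ->
  Cmod (logL (x, y)) <= M0 + C2 * (C1 * l + M0).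
Proof.
  intros Hx Hy. assert (Hl := ln_N_ge_2). assert (hp : 0 < h) by (unfold h; lra).
  assert (Hh1 : h < 1) by (unfold h; lra).
  assert (Hb : b < 1 /\ b + h < delta / 7) by (unfold b, h; lra).
  assert (Hl3 : l + 1 < 2 * l ^ 3).
  { assert (4 <= l * l) by nra. replace (l ^ 3) with (l * (l * l)) by ring. nra. }
  assert (Hy3 : forall v, y - h <= v <= y + h -> Rabs v < 2 * l ^ 3).
  { intros v Hv. apply Rabs_le_between in Hy. apply Rabs_def1; lra. }
  assert (S := borel_caratheodory_segment logL x 2 y h (C1 * l) hp ltac:(lra)
    ltac:(intros u v Hu Hv; apply Cderiv_logL; [lra|now apply Hy3])
    ltac:(intros u v Hu Hv; apply Re_logL_lt; [lra|apply Rlt_le; now apply Hy3])).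
  assert (A := Cmod_logL_2 y). assert (A0 := Cmod_ge_0 (logL (2, y))).
  eapply Rle_trans; [exact S|]. apply Rplus_le_compat; [exact A|].
  assert (C1p := C1_pos).
  assert (I1 : 24 * (2 - x) / h <= 48 / h).
  { apply Rmult_le_compat_r; [apply Rlt_le, Rinv_0_lt_compat; lra|lra]. }
  assert (I2 : exp (12 * (2 - x) / h) <= exp (24 / h)).
  { assert (J : 12 * (2 - x) / h <= 24 / h).
    { apply Rmult_le_compat_r; [apply Rlt_le, Rinv_0_lt_compat; lra|lra]. }
    destruct J as [J|J]; [left; now apply exp_increasing|rewrite J; lra]. }
  assert (I0 : 0 <= 24 * (2 - x) / h) by (apply Rlt_le, Rdiv_lt_0_compat; lra).
  assert (P := exp_pos (12 * (2 - x) / h)).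
  assert (Z : 0 < C1 * l) by (apply Rmult_lt_0_compat; lra).
  apply Rmult_le_compat; try lra.
  - apply Rmult_le_pos; lra.
  - unfold C2. apply Rmult_le_compat; lra.
Qed.

(** The order of choices matters: r, X and eps are fixed first, and only then is Y taken so large
    that the truncation error survives multiplication by X^r. *)
Lemma truncated_formula (r : R) (X : nat) : 1 <= r <= l -> (1 <= X)%nat -> r <= INR X ->
  Cmod (logL (RtoC 1) - (linear_trunc m c X (RtoC 1) + C_const m c 1)) <=
    36 * INR m / r + 6 * (C3 * l) / (r * r) + 6 * r * (C3 * l) * Rpower (INR X) (- b) / b.
Proof.
  intros Hr HX HrX. assert (Hl := ln_N_ge_2). assert (M := pos_INR m).
  assert (M0p := M0_nonneg). assert (C1p := C1_pos). assert (C2p := C2_pos).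
  assert (X1 : 1 <= INR X) by (apply (le_INR 1); auto).
  set (lx := ln (INR X)).
  assert (Hlx : 0 <= lx) by (unfold lx; rewrite <- ln_1; apply ln_le; lra).
  assert (Hb : 0 < b <= 11 / 24 /\ b < delta / 7) by (unfold b; lra).
  assert (Hl3 : l + 1 < 2 * l ^ 3).
  { assert (4 <= l * l) by nra. replace (l ^ 3) with (l * (l * l)) by ring. nra. }
  apply le_epsilon. intros eps Heps.
  (* The first summand is the amplification in [newman]; the 1 pays for exchanging [higher_trunc] at
     s = 1 for C(1). *)
  set (W := 12 * exp (lx * r) + 1).
  assert (W1 : 1 <= W) by (unfold W; generalize (exp_pos (lx * r)); lra).
  destruct (trunc_err_small m (eps / W) ltac:(apply Rdiv_lt_0_compat; lra)) as [Y [HY [T0 T1]]].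
  set (e := trunc_err m Y) in *.
  set (g := fun w => (logL (1 + w) - higher_trunc m c Y (1 + w))%C).
  set (S := fun w => linear_trunc m c X (1 + w)%C).
  assert (E : Cmod (g 0 - S 0)%C <=
    12 * INR m / r + 12 * (2 * INR m) / r + 6 * (C3 * l) / (r * r)
      + 6 * r * (C3 * l) * exp (- (b * lx)) / b + 12 * e * exp (lx * r)).
  { apply newman; try lra.
    - intros x y Hx Hy.
      destruct (Cderiv_shift1 logL (x, y)) as [k1 H1].
      { rewrite Cplus_1_pair. apply Cderiv_logL; [lra|]. apply Rabs_def1; lra. }
      destruct (Cderiv_shift1 (higher_trunc m c Y) (x, y) (Cderiv_higher_trunc m c Y _)) as [k2 H2].
      eexists. apply Cderiv_minus; eassumption.
    - intros w. apply Cderiv_shift1, Cderiv_linear_trunc.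
    - intros x y Hx Hy. unfold g, S. rewrite Cplus_1_pair.
      destruct Hlog as [_ [_ Hs]]. rewrite Hs by (simpl; lra).
      assert (A := log_series_approx m c Hc (1 + x, y) X Y HX HY ltac:(simpl; lra)).
      simpl (Re (1 + x, y)) in A. replace (1 + x - 1) with x in A by ring.
      replace (exp (- (lx * x))) with (Rpower (INR X) (- x)) by (unfold Rpower, lx; f_equal; ring).
      unfold Rdiv in *. rewrite Rmult_assoc. exact A.
    - intros x y Hx Hy. unfold g. rewrite Cplus_1_pair.
      eapply Rle_trans; [apply Cmod_minus_triangle|].
      assert (A := Cmod_logL_left (1 + x) y ltac:(lra) ltac:(apply Rabs_le; lra)).
      assert (B := higher_trunc_bound m c Hc (1 + x, y) Y HY ltac:(simpl; lra)).
      (* In [C3 * l] the constant terms are multiplied by l as well, which is harmless as l >= 1. *)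
      unfold C3.
      replace ((M0 + C2 * (C1 + M0) + 48 * INR m) * l)
        with (M0 * l + C2 * (C1 * l + M0 * l) + 48 * INR m * l) by ring.
      assert (M0 <= M0 * l) by nra. assert (48 * INR m <= 48 * INR m * l) by nra.
      assert (C2 * (C1 * l + M0) <= C2 * (C1 * l + M0 * l)) by (apply Rmult_le_compat_l; lra).
      lra.
    - intros x y Hx Hy. unfold S. rewrite Cplus_1_pair.
      assert (A := linear_trunc_bound m c Hc (1 + x, y) X HX ltac:(simpl; lra)).
      simpl (Re (1 + x, y)) in A. replace (1 - (1 + x)) with (- x) in A by ring.
      replace (exp (- (lx * x))) with (Rpower (INR X) (- x)) by (unfold Rpower, lx; f_equal; ring).
      exact A. }
  replace (exp (- (b * lx))) with (Rpower (INR X) (- b)) in E by (unfold Rpower, lx; f_equal; ring).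
  assert (F := higher_series_approx m c Hc 1 Y HY ltac:(simpl; lra)). fold e in F.
  change (higher_series m c 1) with (C_const m c 1) in F.
  unfold g, S in E. rewrite Cplus_0_r in E.
  replace (logL 1 - (linear_trunc m c X 1 + C_const m c 1))%C
    with ((logL 1 - higher_trunc m c Y 1 - linear_trunc m c X 1)
      - (C_const m c 1 - higher_trunc m c Y 1))%C by ring.
  eapply Rle_trans; [apply Cmod_minus_triangle|].
  assert (G : e * W <= eps).
  { apply Rmult_le_compat_r with (r := W) in T1; [|lra].
    replace (eps / W * W) with eps in T1 by (field; lra). exact T1. }
  unfold W in G.
  (* Here m' = 2 m, the 2 coming from [Rpower_head], so 36 = 12 + 24. *)
  replace (36 * INR m / r) with (12 * INR m / r + 12 * (2 * INR m) / r) by (field; lra).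
  lra.
Qed.

Lemma primes_sum_linear_trunc (x : R) :
  Iter.iter Cplus (RtoC 0) (primes_le x) (fun p => d_coef m c p 1 / INR p)%C =
  linear_trunc m c (Z.to_nat (Int_part x)) (RtoC 1).
Proof.
  unfold primes_le, linear_trunc. rewrite iter_filter_csum.
  apply csum_ext. intros k _. destruct (primeb k) eqn:E; [|reflexivity].
  apply primeb_prime in E. destruct E as [_ E].
  assert (K2 : 2 <= INR k) by (apply (le_INR 2); auto).
  unfold log_term. f_equal. f_equal.
  unfold npow. simpl (INR 1). rewrite !Cmult_1_l. unfold Cexp; simpl.
  replace (0 * ln (INR k)) with 0 by ring.
  rewrite exp_ln by lra. rewrite cos_0, sin_0. unfold RtoC. f_equal; ring.
Qed.

Lemma log_L1_formula :
  Cmod (logL (RtoC 1) -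
     (Iter.iter Cplus (RtoC 0) (primes_le (Rpower l (14 / delta)))
        (fun p => d_coef m c p 1 / INR p) + C_const m c 1))%C
  <= 6 * (36 * INR m + 6 * C3 + 12 * C3 / b) / ln l.
Proof.
  assert (Hl := ln_N_ge_2). assert (M := pos_INR m).
  assert (M0p := M0_nonneg). assert (C1p := C1_pos). assert (C2p := C2_pos).
  assert (C3p : 0 <= C3) by (unfold C3; nra).
  assert (Hb : 0 < b <= 1) by (unfold b; lra).
  set (x := Rpower l (14 / delta)).
  assert (Hx0 : 0 < x) by apply Rpower_pos.
  (* 14/delta > 4 because delta < 7/2; this gives r <= l <= X and X >= x/2 below. *)
  assert (Hx : l ^ 4 <= x).
  { unfold x. rewrite <- Rpower_pow by lra. apply Rle_Rpower; [lra|]. simpl.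
    apply Rmult_le_reg_r with delta; [lra|]. field_simplify; lra. }
  assert (l4 : l + 1 <= l ^ 4).
  { assert (4 <= l * l) by nra. replace (l ^ 4) with (l * l * (l * l)) by ring. nra. }
  rewrite primes_sum_linear_trunc.
  set (X := Z.to_nat (Int_part x)).
  destruct (base_Int_part x) as [I1 I2].
  assert (EX : INR X = IZR (Int_part x)).
  { unfold X. rewrite INR_IZR_INZ, Z2Nat.id; auto.
    apply le_IZR. assert (-1 < IZR (Int_part x)) by lra.
    apply lt_IZR in H. apply IZR_le. lia. }
  rewrite <- EX in I1, I2.
  assert (X1 : 1 <= INR X) by lra.
  assert (HX : (1 <= X)%nat) by (apply INR_le; simpl; lra).
  (* In terms of y = l^(1/6) all sizes are integral powers: l = y^6, r = y^4 and x^b = y^11, as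
     (14/delta) b = 11/6. *)
  set (y := Rpower l (1 / 6)).
  assert (y1 : 1 <= y) by (unfold y; rewrite <- (Rpower_O l) at 1 by lra; apply Rle_Rpower; lra).
  assert (ly : l = y ^ 6).
  { unfold y. rewrite <- Rpower_pow by apply Rpower_pos. rewrite Rpower_mult. simpl.
    replace (1 / 6 * (1 + 1 + 1 + 1 + 1 + 1)) with 1 by field. rewrite Rpower_1; lra. }
  assert (y4 : 1 <= y ^ 4) by (apply pow_R1_Rle; lra).
  assert (y46 : y ^ 4 <= l).
  { rewrite ly. replace (y ^ 6) with (y ^ 4 * (y * y)) by ring. nra. }
  assert (T := truncated_formula (y ^ 4) X (conj y4 y46) HX ltac:(lra)).
  eapply Rle_trans; [exact T|].
  (* The floor costs at most a factor 2: X >= x/2 and 2^b <= 2. *)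
  assert (XB : Rpower (INR X) (- b) <= 2 / y ^ 11).
  { apply Rle_trans with (Rpower (x * / 2) (- b)).
    - apply Rpower_antitone; lra.
    - rewrite <- Rpower_mult_distr by lra.
      replace (Rpower x (- b)) with (/ y ^ 11).
      2:{ unfold x, y. rewrite <- Rpower_pow by apply Rpower_pos.
          rewrite !Rpower_mult, <- Rpower_Ropp. f_equal. unfold b. simpl. field. lra. }
      replace (2 / y ^ 11) with (/ y ^ 11 * 2) by (unfold Rdiv; ring).
      apply Rmult_le_compat_l.
      + apply Rlt_le, Rinv_0_lt_compat, pow_lt. lra.
      + unfold Rpower. rewrite ln_Rinv by lra.
        replace (- b * - ln 2) with (b * ln 2) by ring.
        rewrite <- (exp_ln 2) at 2 by lra.
        assert (L2 : 0 < ln 2) by (rewrite <- ln_1; apply ln_increasing; lra).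
        assert (J : b * ln 2 <= ln 2) by nra.
        destruct J as [J|J]; [left; now apply exp_increasing|rewrite J; lra]. }
  assert (yi : 0 < / y) by (apply Rinv_0_lt_compat; lra).
  (* The three terms have sizes y^(-4), y^(6-8) and y^(4+6-11); the last one dictates the exponent
     1/6. *)
  assert (Up : 36 * INR m / y ^ 4 + 6 * (C3 * l) / (y ^ 4 * y ^ 4)
      + 6 * y ^ 4 * (C3 * l) * Rpower (INR X) (- b) / b
      <= (36 * INR m + 6 * C3 + 12 * C3 / b) / y).
  { rewrite ly.
    replace ((36 * INR m + 6 * C3 + 12 * C3 / b) / y)
      with (36 * INR m * / y + 6 * C3 * / y + 12 * C3 / b * / y) by (field; lra).
    apply Rplus_le_compat; [apply Rplus_le_compat|].
    - apply Rmult_le_compat_l; [lra|]. apply Rinv_le_contravar; [lra|].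
      replace (y ^ 4) with (y * (y * (y * y))) by ring.
      assert (1 <= y * y) by nra. assert (1 <= y * (y * y)) by nra. nra.
    - replace (6 * (C3 * y ^ 6) / (y ^ 4 * y ^ 4)) with (6 * C3 * (/ (y * y))) by (field; lra).
      apply Rmult_le_compat_l; [lra|]. apply Rinv_le_contravar; [lra|]. nra.
    - apply Rle_trans with (6 * y ^ 4 * (C3 * y ^ 6) * (2 / y ^ 11) / b).
      + apply Rmult_le_compat_r; [apply Rlt_le, Rinv_0_lt_compat; lra|].
        apply Rmult_le_compat_l; [|exact XB].
        assert (0 <= y ^ 6) by (apply pow_le; lra).
        apply Rmult_le_pos; [lra|]. now apply Rmult_le_pos.
      + apply Req_le. field. lra. }
  eapply Rle_trans; [exact Up|].
  assert (Lp : 0 < ln l) by (rewrite <- ln_1; apply ln_increasing; lra).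
  (* The power saving 1/y is weakened to 1 / ln l through ln l = 6 ln y <= 6 y. *)
  assert (Ll : ln l <= 6 * y).
  { assert (E : ln l = 6 * ln y) by (unfold y, Rpower; rewrite ln_exp; field).
    assert (J : ln y <= y).
    { rewrite <- (ln_exp y) at 2. apply ln_le; [lra|]. generalize (exp_ineq1_le y); lra. }
    lra. }
  set (Q := 36 * INR m + 6 * C3 + 12 * C3 / b) in *.
  assert (Q0 : 0 <= Q).
  { assert (0 <= C3 / b) by (apply Rmult_le_pos; [lra|apply Rlt_le, Rinv_0_lt_compat; lra]).
    unfold Q. replace (12 * C3 / b) with (12 * (C3 / b)) by (field; lra). lra. }
  replace (6 * Q / ln l) with (Q * (6 / ln l)) by (field; lra).
  apply Rmult_le_compat_l; [exact Q0|].
  apply Rmult_le_reg_r with (y * ln l); [apply Rmult_lt_0_compat; lra|].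
  replace (/ y * (y * ln l)) with (ln l) by (field; lra).
  replace (6 / ln l * (y * ln l)) with (6 * y) by (field; lra). exact Ll.
Qed.

End Assembly.

Theorem theorem2 :
  forall (m : nat) (delta gamma1 gamma2 K : R),
    (1 <= m)%nat ->
    0 < delta < 7 / 2 ->
    0 < gamma1 -> 0 < gamma2 -> 0 < K ->
    exists B : R,
      forall (N : nat) (c : nat -> nat -> C) (L logL : C -> C) (sigmaL : R),
        (16 <= N)%nat ->
        (forall p j : nat, prime (Z.of_nat p) -> (1 <= j <= m)%nat ->
           Cmod (c p j) <= 1) ->
        (forall s : C, 1 < Re s -> euler_product m c s (L s)) ->
        1 / 2 <= sigmaL < 1 ->
        delta < 7 * (1 - sigmaL) ->
        holomorphic_on (fun s => sigmaL <= Re s) L ->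
        (forall s : C, D_region delta N s -> L s <> RtoC 0) ->
        (forall s : C, sigmaL < Re s < 4 ->
           Cmod (L s) <=
             K * Rpower (INR N) gamma1 * Rpower (1 + Rabs (Im s)) gamma2) ->
        is_log_branch m c L (D_region delta N) logL ->
        Cmod (logL (RtoC 1) -
              (Iter.iter Cplus (RtoC 0)
                 (primes_le (Rpower (ln (INR N)) (14 / delta)))
                 (fun p => d_coef m c p 1 / INR p)
               + C_const m c 1))%C
        <= B / ln (ln (INR N)).
Proof.
  (* B is found by unification with [log_L1_formula]; its constant is built from m, delta, gamma1,
     gamma2 and K alone, hence uniform in N, c and L. *)
  intros m delta gamma1 gamma2 K _ Hd H1 H2 HK. eexists.
  intros N c L logL sigmaL HN Hc _ _ Hs _ _ HL Hlog.
  exact (log_L1_formula m delta gamma1 gamma2 K Hd H1 H2 HK N c L logL sigmaL HN Hc Hs HL Hlog).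
Qed.
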